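(* Let $\mathcal{M},\mathcal{N}$ be von Neumann algebras and let $\Phi,\Psi\in\mathrm{CP}(\mathcal{M},\mathcal{N})$. Then, with respect to the order $\le_{\mathrm{cp}}$, \[ \Phi:\Psi=\max\left\{\Theta\in\mathrm{CP}(\mathcal{M},\mathcal{N})\;\middle|\;\begin{bmatrix}\Phi&\Phi\\ \Phi&\Phi+\Psi\end{bmatrix}\ge_{\mathrm{cp}}\begin{bmatrix}\Theta&0\\0&0\end{bmatrix}\right\}, \] i.e. $\Phi:\Psi$ belongs to the set on the right-hand side and dominates (in $\le_{\mathrm{cp}}$) every element of it.
   Context: $\mathrm{CP}(\mathcal{M},\mathcal{N})$ is the set of all completely positive (CP) maps $\mathcal{M}\to\mathcal{N}$ (not assumed normal). $\Phi\le_{\mathrm{cp}}\Psi$ means $\Psi-\Phi$ is CP. A $2\times2$ matrix $[\Phi_{ij}]$ of linear maps $\mathcal{M}\to\mathcal{N}$ is identified with the map $\mathcal{M}\to M_2(\mathcal{N})$, $x\mapsto[\Phi_{ij}(x)]$, and $[\Phi_{ij}]\ge_{\mathrm{cp}}[\Psi_{ij}]$ means that the difference of the two maps is CP. Forms: for a complex vector space $\mathcal{V}$, $F_+(\mathcal{V})$ is the set of positive sesquilinear forms on $\mathcal{V}$ (linear in the first variable). A compatible representation of $\alpha,\beta\in F_+(\mathcal{V})$ consists of a linear map $h$ from $\mathcal{V}$ onto a dense subspace of a Hilbert space $\mathcal{H}$ and commuting positive $A,B\in\mathbb{B}(\mathcal{H})$ with $\alpha(x,y)=\langle Ah(x),h(y)\rangle$,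 $\beta(x,y)=\langle Bh(x),h(y)\rangle$. By Pusz–Woronowicz such representations always exist, and for a homogeneous locally bounded Borel function $f$ on $[0,\infty)^2$ the form $f(\alpha,\beta)(x,y):=\langle f(A,B)h(x),h(y)\rangle$ does not depend on the choice. The parallel sum is $\alpha:\beta:=f(\alpha,\beta)$ with $f(r,s)=\frac{rs}{r+s}$ (and $0/0=0$). CP maps: $L^2(\mathcal{N})$ is the standard form Hilbert space of $\mathcal{N}$. For $\Phi\in\mathrm{CP}(\mathcal{M},\mathcal{N})$, $s_\Phi$ is the positive sesquilinear form on the algebraic tensor product $\mathcal{M}\odot L^2(\mathcal{N})$ given by $s_\Phi(x\otimes\xi,y\otimes\eta)=\langle\Phi(y^*x)\xi,\eta\rangle$. The parallel sum $\Phi:\Psi\in\mathrm{CP}(\mathcal{M},\mathcal{N})$ is the unique CP map with $\langle(\Phi:\Psi)(y^*x)\xi,\eta\rangle=(s_\Phi:s_\Psi)(x\otimes\xi,y\otimes\eta)$ for all $x,y\in\mathcal{M}$, $\xi,\eta\in L^2(\mathcal{N})$. *)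

(* Defs.v *)
From HB Require Import structures.
From mathcomp Require Import all_boot all_order all_algebra sesquilinear.
From mathcomp Require Import complex.
From mathcomp Require Import all_classical all_reals all_analysis.
Import numFieldNormedType.Exports.
Import Order.TTheory GRing.Theory Num.Theory.

Set Implicit Arguments.
Unset Strict Implicit.
Unset Printing Implicit Defensive.

Local Open Scope classical_set_scope.
Local Open Scope ring_scope.
Local Open Scope complex_scope.

(* Inner products are linear in the first variable. *)
Record hilbert (R : realType) := Hilbert {
  hilb_sort :> completeNormedModType R[i] ;
  inner : {dot hilb_sort for (@Num.conj R[i])} ;
  inner_norm : forall x, `|x| ^+ 2 = inner x x }.

Notation "''[' x , y ]" := (inner _ x y)
  (at level 0, format "''[' x ,  y ]") : ring_scope.

Section BoundedOperators.
Context {R : realType}.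

Definition bounded_linear (H : hilbert R) : {pred H -> H} :=
  fun f => `[< linear f /\ exists c : R[i], forall x, `|f x| <= c * `|x| >].

Lemma bounded_linear_submod (H : hilbert R) :
  submod_closed (@bounded_linear H).
Proof.
split.
  apply/asboolP; split; first by move=> a x y /=; rewrite scaler0 addr0.
  by exists 0 => x; rewrite mul0r normr0.
move=> a f g /asboolP[lf [c fc]] /asboolP[lg [d gd]]; apply/asboolP; split.
  move=> b x y; have E z : (a *: f + g) z = a *: f z + g z by [].
  by rewrite !E lf lg !scalerDr !scalerA addrACA (mulrC a b).
exists (`|a| * c + d) => x.
rewrite (le_trans (ler_normD _ _)) // mulrDl lerD // normrZ -mulrA.
exact: ler_wpM2l.
Qed.

HB.instance Definition _ (H : hilbert R) :=
  GRing.isSubmodClosed.Build R[i] (H -> H) (@bounded_linear H)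
    (@bounded_linear_submod H).

(* B(H) *)
Record bop (H : hilbert R) := Bop {
  bop_fun :> H -> H ;
  bop_bounded : bop_fun \in @bounded_linear H }.

HB.instance Definition _ (H : hilbert R) := [isSub for @bop_fun H].
HB.instance Definition _ (H : hilbert R) := [Choice of bop H by <:].
HB.instance Definition _ (H : hilbert R) :=
  [SubChoice_isSubLmodule of bop H by <:].

Lemma bop_linear (H : hilbert R) (a : bop H) : linear a.
Proof. by case: a => f /= /asboolP[]. Qed.

Lemma bop1_subproof (H : hilbert R) : idfun \in @bounded_linear H.
Proof. by apply/asboolP; split=> //; exists 1 => x; rewrite mul1r. Qed.

Definition bop1 (H : hilbert R) : bop H := Bop (bop1_subproof H).

Lemma bopM_subproof (H : hilbert R) (a b : bop H) :
  a \o b \in @bounded_linear H.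
Proof.
case: a b => [f /= /asboolP[lf [c fc]]] [g /= /asboolP[lg [d gd]]].
apply/asboolP; split; first by move=> k x y /=; rewrite lg lf.
exists (`|c| * d) => x /=; rewrite (le_trans (fc _)) //.
rewrite -mulrA (@le_trans _ _ (`|c| * `|g x|)) //; last exact: ler_wpM2l.
have [g0|g0] := eqVneq `|g x| 0; first by rewrite g0 !mulr0.
have gp : 0 < `|g x| by rewrite lt_neqAle eq_sym g0 normr_ge0.
apply: ler_wpM2r => //; have := le_trans (normr_ge0 _) (fc (g x)).
by rewrite pmulr_lge0 // => c0; rewrite ger0_norm.
Qed.

Definition bopM (H : hilbert R) (a b : bop H) : bop H :=
  Bop (bopM_subproof a b).

Definition is_adjoint (H : hilbert R) (a b : bop H) : Prop :=
  forall x y, '[a x, y] = '[x, b y].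

Definition op_pos (H : hilbert R) (a : bop H) : Prop :=
  forall x, 0 <= '[a x, x].

Definition commutant (H : hilbert R) (S : set (bop H)) : set (bop H) :=
  [set a | forall b, S b -> bopM a b = bopM b a].

End BoundedOperators.

Record vnalg (R : realType) (H : hilbert R) := VNAlg {
  vn_set : set (bop H) ;
  vn_star : forall a, vn_set a -> exists2 b, vn_set b & is_adjoint a b ;
  vn_bicommutant : commutant (commutant vn_set) = vn_set }.

Section VonNeumannAlgebra.
Context {R : realType} {H : hilbert R}.
Implicit Type M : vnalg H.

Definition vn_pred M : {pred bop H} := fun a => `[< vn_set M a >].

Lemma vn_predE M a : (a \in vn_pred M) <-> vn_set M a.
Proof. by split=> /asboolP. Qed.

Lemma bopP (a b : bop H) : (forall x, a x = b x) -> a = b.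
Proof. by move=> ab; apply: val_inj; apply: funext. Qed.

Lemma vn_submod M : submod_closed (vn_pred M).
Proof.
split.
  apply/vn_predE; rewrite -vn_bicommutant => b _; apply: bopP => x /=.
  by have := bop_linear b (-1) 0 0; rewrite scaler0 addr0 scaleN1r addNr.
move=> k a b /vn_predE; rewrite -vn_bicommutant => aM /vn_predE.
rewrite -vn_bicommutant => bM; apply/vn_predE.
rewrite -vn_bicommutant => c cM; apply: bopP => x /=.
have /(congr1 (fun f : bop H => f x)) /= ac := aM _ cM.
have /(congr1 (fun f : bop H => f x)) /= bc := bM _ cM.
rewrite [LHS](_ : _ = k *: a (c x) + b (c x)) // ac bc -bop_linear.
by [].
Qed.

HB.instance Definition _ M :=
  GRing.isSubmodClosed.Build R[i] (bop H) (vn_pred M) (vn_submod M).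

Record vn_elt M := VNElt {
  vn_op :> bop H ;
  vn_opP : vn_op \in vn_pred M }.

HB.instance Definition _ M := [isSub for @vn_op M].
HB.instance Definition _ M := [Choice of vn_elt M by <:].
HB.instance Definition _ M := [SubChoice_isSubLmodule of vn_elt M by <:].

Lemma vn1_subproof M : bop1 H \in vn_pred M.
Proof.
by apply/vn_predE; rewrite -vn_bicommutant => b _; apply: bopP.
Qed.

Definition vn1 M : vn_elt M := VNElt (vn1_subproof M).

Lemma vnM_subproof M (a b : vn_elt M) : bopM a b \in vn_pred M.
Proof.
case: a b => [a /= /vn_predE]; rewrite -vn_bicommutant => aM.
case=> [b /= /vn_predE]; rewrite -vn_bicommutant => bM.
apply/vn_predE; rewrite -vn_bicommutant => c cM; apply: bopP => x /=.
have /(congr1 (fun f : bop H => f (b x))) /= <- := aM _ cM.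
by have /(congr1 (fun f : bop H => f x)) /= <- := bM _ cM.
Qed.

Definition vnM M (a b : vn_elt M) : vn_elt M := VNElt (vnM_subproof a b).

Lemma vn_adj_exists M (a : vn_elt M) :
  exists b : vn_elt M, is_adjoint a b.
Proof.
have /vn_predE/vn_star[b bM ab] := vn_opP a.
by have bM' := (vn_predE M b).2 bM; exists (VNElt bM').
Qed.

Definition vn_adj M (a : vn_elt M) : vn_elt M := sval (cid (vn_adj_exists a)).

Lemma vn_adjP M (a : vn_elt M) : is_adjoint a (vn_adj a).
Proof. exact: svalP (cid (vn_adj_exists a)). Qed.

End VonNeumannAlgebra.

Coercion vn_elt : vnalg >-> Sortclass.

(* A linear space of operators acting on an inner product space; it makes one
   notion of complete positivity serve both N and M_k(N). *)
Record opspace (R : realType) := OpSpace {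
  os_sort :> lmodType R[i] ;
  os_vec : Type ;
  os_dot : os_vec -> os_vec -> R[i] ;
  os_act : os_sort -> os_vec -> os_vec }.

Section CompletePositivity.
Context {R : realType}.

Definition vn_opspace (H : hilbert R) (M : vnalg H) : opspace R :=
  @OpSpace R (vn_elt M) H (fun x y => '[x, y]) (fun a x => a x).

(* M_k(N), acting on the direct sum of k copies of the space of N. *)
Definition mat_opspace (k : nat) (K : hilbert R) (N : vnalg K) : opspace R :=
  @OpSpace R ('I_k -> 'I_k -> N) ('I_k -> K)
    (fun x y => \sum_i '[x i, y i])
    (fun a x => fun i => \sum_j a i j (x j)).

(* Positivity in M_n(A), acting on the direct sum of n copies of [os_vec A]. *)
Definition mat_pos (A : opspace R) (n : nat) (X : 'I_n -> 'I_n -> A) : Prop :=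
  forall x : 'I_n -> os_vec A,
    0 <= \sum_i \sum_j os_dot (os_act (X i j) (x j)) (x i).

Definition completely_positive (A B : opspace R) (Phi : A -> B) : Prop :=
  linear Phi /\
  forall n (X : 'I_n -> 'I_n -> A),
    mat_pos X -> mat_pos (fun i j => Phi (X i j)).

Definition cp_le (A B : opspace R) (Phi Psi : A -> B) : Prop :=
  completely_positive (Psi - Phi).

Definition CP (H K : hilbert R) (M : vnalg H) (N : vnalg K) : set (M -> N) :=
  [set Phi | @completely_positive (vn_opspace M) (vn_opspace N) Phi].

Definition mx22 (T : Type) (a b c d : T) : 'I_2 -> 'I_2 -> T :=
  fun i j => if i == 0 then (if j == 0 then a else b)
             else (if j == 0 then c else d).

(* The map x |-> [Phi_ij(x)] into M_2(N). *)
Definition matmap (H K : hilbert R) (M : vnalg H) (N : vnalg K)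
    (F : 'I_2 -> 'I_2 -> M -> N) : vn_opspace M -> mat_opspace 2 N :=
  fun x i j => F i j x.

End CompletePositivity.
Arguments CP {R H K} M N _.

(* Haagerup's standard form (N, L^2(N), J, P); [sf_rep] is a *-isomorphism
   of N onto a von Neumann algebra (so automatically normal). *)
Record standard_form (R : realType) (K : hilbert R) (N : vnalg K) :=
  StandardForm {
  sf_space : hilbert R ;
  sf_rep : N -> bop sf_space ;
  sf_J : sf_space -> sf_space ;
  sf_cone : set sf_space ;
  sf_rep_linear : linear sf_rep ;
  sf_rep1 : sf_rep (vn1 N) = bop1 sf_space ;
  sf_repM : forall a b, sf_rep (vnM a b) = bopM (sf_rep a) (sf_rep b) ;
  sf_rep_adj : forall a, is_adjoint (sf_rep a) (sf_rep (vn_adj a)) ;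
  sf_rep_inj : injective sf_rep ;
  sf_rep_vn : commutant (commutant (range sf_rep)) = range sf_rep ;
  sf_J_antilinear : forall (k : R[i]) x y,
    sf_J (k *: x + y) = k^* *: sf_J x + sf_J y ;
  sf_J_isometric : forall x, `|sf_J x| = `|x| ;
  sf_J_involutive : involutive sf_J ;
  sf_cone_selfdual :
    sf_cone = [set x | forall y, sf_cone y -> 0 <= '[x, y]] ;
  sf_J_commutant :
    commutant (range sf_rep) =
    [set b : bop sf_space |
       exists a, forall x, b x = sf_J (sf_rep a (sf_J x))] ;
  sf_J_center : forall c : N, (forall a : N, vnM a c = vnM c a) ->
    forall x, sf_J (sf_rep c (sf_J x)) = sf_rep (vn_adj c) x ;
  sf_J_cone : forall x, sf_cone x -> sf_J x = x ;
  sf_cone_stable : forall a x, sf_cone x ->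
    sf_cone (sf_rep a (sf_J (sf_rep a (sf_J x)))) }.

(* Algebraic tensor product of vector spaces, realised as the span of the
   evaluations b |-> b(u,v) inside the functions on the bilinear forms of
   U x V; this is the tensor product because linear functionals separate the
   points of U (.) V. *)
Section TensorProduct.
Context {F : fieldType} {U V : lmodType F}.

Definition bilform := {bilinear U -> V -> F | *%R & *%R}.

Definition tens_fun (u : U) (v : V) : bilform -> F^o := fun b => b u v.

Definition tens_pred : {pred bilform -> F^o} := fun t =>
  `[< exists n (u : 'I_n -> U) (v : 'I_n -> V),
        t = \sum_i tens_fun (u i) (v i) >].

Lemma tens_submod : submod_closed tens_pred.
Proof.
split.
  by apply/asboolP; exists 0%N, (fun=> 0), (fun=> 0); rewrite big_ord0.
move=> k s t /asboolP[m [u [v ->]]] /asboolP[n [u' [v' ->]]].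
apply/asboolP; exists (m + n)%N,
  (fun i : 'I_(m + n) => match fintype.split i with inl j => k *: u j | inr j => u' j end),
  (fun i : 'I_(m + n) => match fintype.split i with inl j => v j | inr j => v' j end).
rewrite big_split_ord /= scaler_sumr; congr (_ + _); apply: eq_bigr => i _.
- rewrite -[lshift n i]/(unsplit (inl i)) unsplitK; apply/funext => b.
  by rewrite /tens_fun linearZl_LR.
- by rewrite -[rshift m i]/(unsplit (inr i)) unsplitK.
Qed.

HB.instance Definition _ :=
  GRing.isSubmodClosed.Build F (bilform -> F^o) tens_pred tens_submod.

Record tensor := Tensor {
  tensor_val : bilform -> F^o ;
  tensor_valP : tensor_val \in tens_pred }.

HB.instance Definition _ := [isSub for tensor_val].
HB.instance Definition _ := [Choice of tensor by <:].
HB.instance Definition _ := [SubChoice_isSubLmodule of tensor by <:].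

Lemma tens_subproof u v : tens_fun u v \in tens_pred.
Proof.
by apply/asboolP; exists 1%N, (fun=> u), (fun=> v); rewrite big_ord1.
Qed.

Definition tens (u : U) (v : V) : tensor := Tensor (tens_subproof u v).

End TensorProduct.
Arguments tensor {F} U V.

Section Forms.
Context {R : realType}.

(* F_+(V) *)
Record posform (V : lmodType R[i]) := PosForm {
  pf_form :> {bilinear V -> V -> R[i] | *%R & (@Num.conj R[i] \; *%R)} ;
  pf_ge0 : forall x, 0 <= pf_form x x }.

Definition quadrant : set (R * R) := [set z | 0 <= z.1 /\ 0 <= z.2].

(* Projection-valued measure on the Borel sets of [0,+oo)^2, with its scalar
   measures S |-> <E(S) x, x>. *)
Record spectral_measure (H : hilbert R) := SpectralMeasure {
  spm_proj : set (R * R) -> bop H ;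
  spm_scalar : H -> {measure set (R * R) -> \bar R} ;
  spm_idem : forall S, measurable S ->
    bopM (spm_proj S) (spm_proj S) = spm_proj S ;
  spm_selfadj : forall S, measurable S ->
    is_adjoint (spm_proj S) (spm_proj S) ;
  spm_setT : spm_proj setT = bop1 H ;
  spm_setI : forall S T, measurable S -> measurable T ->
    spm_proj (S `&` T) = bopM (spm_proj S) (spm_proj T) ;
  spm_quadrant : spm_proj (~` quadrant) = 0 ;
  spm_scalarE : forall x S, measurable S ->
    spm_scalar x S = (complex.Re '[spm_proj S x, x])%:E }.

(* T is the integral of f with respect to E. *)
Definition spectral_integral (H : hilbert R) (E : spectral_measure H)
    (f : R * R -> R) (T : bop H) : Prop :=
  forall x,
    (spm_scalar E x).-integrable quadrant (EFin \o f) /\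
    '[T x, x] = (\int[spm_scalar E x]_(z in quadrant) f z)%:C.

(* T = f(A,B), where E is the joint spectral measure of A and B. *)
Definition borel_calculus (H : hilbert R) (A B : bop H) (f : R * R -> R)
    (T : bop H) : Prop :=
  exists E : spectral_measure H,
    [/\ spectral_integral E fst A, spectral_integral E snd B &
        spectral_integral E f T].

Record compatible_rep (V : lmodType R[i]) (alpha beta : posform V) :=
  CompatibleRep {
  cr_space : hilbert R ;
  cr_map : {linear V -> cr_space} ;
  cr_A : bop cr_space ;
  cr_B : bop cr_space ;
  cr_dense : dense (range cr_map) ;
  cr_comm : bopM cr_A cr_B = bopM cr_B cr_A ;
  cr_A_pos : op_pos cr_A ;
  cr_B_pos : op_pos cr_B ;
  cr_alpha : forall x y, alpha x y = '[cr_A (cr_map x), cr_map y] ;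
  cr_beta : forall x y, beta x y = '[cr_B (cr_map x), cr_map y] }.

(* gamma = f(alpha,beta); the choice of the representation is immaterial. *)
Definition is_form_calculus (V : lmodType R[i]) (f : R * R -> R)
    (alpha beta gamma : posform V) : Prop :=
  exists (r : compatible_rep alpha beta) (T : bop (cr_space r)),
    borel_calculus (cr_A r) (cr_B r) f T /\
    forall x y, gamma x y = '[T (cr_map r x), cr_map r y].

(* Division by zero is zero, so the value at the origin is 0. *)
Definition parallel_fun (z : R * R) : R := z.1 * z.2 / (z.1 + z.2).

Definition is_form_parallel_sum (V : lmodType R[i])
    (alpha beta gamma : posform V) : Prop :=
  is_form_calculus parallel_fun alpha beta gamma.

End Forms.

Section ParallelSum.
Context {R : realType} {H K : hilbert R} {M : vnalg H} {N : vnalg K}.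
Variable L : standard_form N.

(* s = s_Phi *)
Definition is_cp_form (Phi : M -> N) (s : posform (tensor M (sf_space L))) :
    Prop :=
  forall x xi y eta,
    s (tens x xi) (tens y eta) =
    '[sf_rep L (Phi (vnM (vn_adj y) x)) xi, eta].

(* Pi = Phi : Psi *)
Definition is_parallel_sum (Phi Psi Pi : M -> N) : Prop :=
  CP M N Pi /\
  exists s t p : posform (tensor M (sf_space L)),
    [/\ is_cp_form Phi s, is_cp_form Psi t, is_form_parallel_sum s t p &
        is_cp_form Pi p].

End ParallelSum.

Definition is_cp_max (R : realType) (H K : hilbert R) (M : vnalg H)
    (N : vnalg K) (S : set (M -> N)) (Pi : M -> N) : Prop :=
  S Pi /\ forall Theta, S Theta -> @cp_le R (vn_opspace M) (vn_opspace N) Theta Pi.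

(* Main.v *)
From HB Require Import structures.
Require Import Defs.
From mathcomp Require Import all_boot all_order all_algebra sesquilinear.
From mathcomp Require Import complex ring lra.
From mathcomp Require Import all_classical all_reals all_analysis.
From mathcomp Require Import measurable_realfun.
Import numFieldNormedType.Exports.
Import Order.TTheory GRing.Theory Num.Theory.

(** The parallel sum of two positive forms has the variational description
    (s : t)(u,u) = inf over v of s(u+v,u+v) + t(v,v).  On the other hand the block
    matrix of Phi, Phi, Phi, Phi + Psi, evaluated at a pair (u,v) of tensors, is
    exactly s(u+v,u+v) + t(v,v).  Hence the block matrix dominates the one of
    Theta if and only if Theta(u,u) <= s(u+v,u+v) + t(v,v) for all u and v
    ([block_cpP]), that is, if and only if Theta lies below s : t, the form of
    the parallel sum: it belongs to the set and is its largest element.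

    The variational formula ([form_parallel_sum_le], [form_parallel_sum_ge]) is
    read off from a compatible representation.  If T = f(A,B) with
    f(r,s) = rs/(r+s), then T (A + B) = A B ([parallel_op_mul]), because the
    spectral calculus is multiplicative ([spectral_mul]).  This identity and
    0 <= T <= A are all that is needed: the minimizer w = A u/(A + B) of
    <A(u-w),u-w> + <Bw,w> is approached by gradient descent, whose cost can be
    computed exactly ([descent_cost]) and converges to <Tu,u>
    ([split_cost_inf], [split_cost_ge]).

    Complete positivity is defined by the action of N on its own Hilbert space,
    the forms by the action on the standard form.  The two notions of positivity
    for matrices over N agree ([rep_opmat_pos]) since a positive operator matrix
    has a square root ([opmat_sqrt]) that commutes with everything its
    entries commute with; by the bicommutant property the entries of the
    root stay in the algebra.  The same square roots, applied in M, reduce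
    complete positivity to Gram matrices ([cp_on_rep]). *)

Set Implicit Arguments.
Unset Strict Implicit.
Unset Printing Implicit Defensive.

Local Open Scope classical_set_scope.
Local Open Scope ring_scope.
Local Open Scope complex_scope.

(** * Positive semidefinite real forms *)

Section PsdForms.
Context {R : realType} {V : lmodType R[i]}.

(** The real part of a positive sesquilinear form.  Cauchy-Schwarz, the triangle
    inequality and all estimates below only involve real parts, and a real-valued
    form lets them be settled in an ordered field. *)
Record psd (b : V -> V -> R) : Prop := Psd {
  psdD : forall x y z, b (x + y) z = b x z + b y z ;
  psdZ : forall (t : R) x y, b (t%:C *: x) y = t * b x y ;
  psdC : forall x y, b x y = b y x ;
  psdi : forall x y, b ('i *: x) ('i *: y) = b x y ;
  psd_ge0 : forall x, 0 <= b x x }.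

Variable b : V -> V -> R.
Hypothesis pb : psd b.
Implicit Types (x y z : V) (t : R).

Lemma psdDr x y z : b z (x + y) = b z x + b z y.
Proof. by rewrite !(psdC pb z) psdD. Qed.

Lemma psdZr t x y : b x (t%:C *: y) = t * b x y.
Proof. by rewrite psdC// psdZ// psdC. Qed.

Lemma psdN x y : b (- x) y = - b x y.
Proof.
have -> : - x = (-1 : R)%:C *: x by rewrite rmorphN rmorph1 scaleN1r.
by rewrite psdZ// mulN1r.
Qed.

Lemma psdNr x y : b x (- y) = - b x y.
Proof. by rewrite psdC// psdN psdC. Qed.

Definition psdE := (psdD pb, psdDr, psdZ pb, psdZr, psdN, psdNr).

Lemma psd0l x : b 0 x = 0.
Proof. by rewrite -(scale0r (0:V)) -(rmorph0 (real_complex R)) psdZ// mul0r. Qed.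

Lemma psd0r x : b x 0 = 0.
Proof. by rewrite psdC// psd0l. Qed.

(** The discriminant of t |-> b (x + t y) (x + t y). *)
Lemma psd_CS x y : b x y ^+ 2 <= b x x * b y y.
Proof.
have q t : 0 <= b x x + 2 * t * b x y + t ^+ 2 * b y y.
  have := psd_ge0 pb (x + t%:C *: y); rewrite !psdE (psdC pb y x) => h.
  by apply: le_trans h _; rewrite le_eqVlt; apply/orP; left; apply/eqP; ring.
have [y0|y0] := eqVneq (b y y) 0.
  have [->|c0] := eqVneq (b x y) 0; first by rewrite y0; lra.
  have := q (- (b x x + 1) / (2 * b x y)).
  rewrite y0 mulr0 addr0 (_ : 2 * _ * _ = - (b x x + 1)); last by field.
  by lra.
have yp : 0 < b y y by rewrite lt_def y0 psd_ge0.
have := mulr_ge0 (ltW yp) (q (- b x y / b y y)).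
rewrite (_ : b y y * _ = b x x * b y y - b x y ^+ 2); first by rewrite subr_ge0.
by field.
Qed.

Definition snorm x : R := Num.sqrt (b x x).

Lemma snorm_ge0 x : 0 <= snorm x. Proof. exact: sqrtr_ge0. Qed.

Lemma snorm_sq x : snorm x ^+ 2 = b x x.
Proof. by rewrite sqr_sqrtr// psd_ge0. Qed.

Lemma psd_le x y : b x y <= snorm x * snorm y.
Proof.
have [h|h] := lerP (b x y) 0.
  by apply: le_trans h _; rewrite mulr_ge0// snorm_ge0.
rewrite -(@ler_pXn2r _ 2) ?nnegrE ?(ltW h) ?mulr_ge0 ?snorm_ge0//.
by rewrite exprMn !snorm_sq psd_CS.
Qed.

Lemma psd_norm_le x y : `|b x y| <= snorm x * snorm y.
Proof.
rewrite ler_norml psd_le andbT.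
have := psd_le (- x) y; rewrite psdN /snorm psdN psdNr opprK; lra.
Qed.

Lemma snormD x y : snorm (x + y) <= snorm x + snorm y.
Proof.
rewrite -(@ler_pXn2r _ 2)// ?nnegrE ?addr_ge0 ?snorm_ge0//.
rewrite snorm_sq !psdE (psdC pb y x) -!snorm_sq.
by have := psd_le x y; rewrite sqrrD; lra.
Qed.

Lemma snormZ t x : snorm (t%:C *: x) = `|t| * snorm x.
Proof. by rewrite /snorm !psdE mulrA -expr2 sqrtrM ?sqr_ge0// sqrtr_sqr. Qed.

Lemma snormN x : snorm (- x) = snorm x.
Proof. by rewrite /snorm !psdE opprK. Qed.

Lemma snormB x y : snorm (x - y) <= snorm x + snorm y.
Proof. by rewrite -(snormN y) snormD. Qed.

Lemma snorm_sub x y z : snorm (x - z) <= snorm (x - y) + snorm (y - z).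
Proof. by rewrite -[x - z](_ : (x - y) + (y - z) = _) ?snormD// addrA subrK. Qed.

(** Complex scalars are not controlled by real homogeneity; splitting
    k = Re k + i Im k and using invariance under i gives a cruder constant, which
    suffices for continuity. *)
Lemma snorm_scale (k : R[i]) : exists2 c : R,
  0 <= c & forall x, snorm (k *: x) <= c * snorm x.
Proof.
exists (`|complex.Re k| + `|complex.Im k|); first by rewrite addr_ge0.
move=> x; have -> : k *: x =
    (complex.Re k)%:C *: x + (complex.Im k)%:C *: ('i *: x).
  rewrite scalerA -scalerDl; congr (_ *: _).
  case: k => p q /=; rewrite /GRing.mul /GRing.add /=.
  by rewrite !(mulr0, mulr1, mul0r, subr0, addr0, add0r).
apply: le_trans (snormD _ _) _; rewrite !snormZ mulrDl lerD2l.
by rewrite {1}/snorm psdi.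
Qed.

End PsdForms.

(** * Bounded operators on a Hilbert space *)

Section ComplexParts.
Context {R : realType}.
Implicit Types z w : R[i].

Lemma complex_ReD z w : complex.Re (z + w) = complex.Re z + complex.Re w.
Proof. by case: z w => [? ?] [? ?]. Qed.
Lemma complex_ImD z w : complex.Im (z + w) = complex.Im z + complex.Im w.
Proof. by case: z w => [? ?] [? ?]. Qed.
Lemma complex_ReZ (t : R) z : complex.Re (t%:C * z) = t * complex.Re z.
Proof. by case: z => a c /=; rewrite mul0r subr0. Qed.
Lemma complex_Im_i z : complex.Im ('i * z) = complex.Re z.
Proof. by case: z => a c /=; rewrite mul0r mul1r add0r. Qed.
Lemma complex_Re_conj z : complex.Re z^* = complex.Re z.
Proof. by case: z. Qed.
Lemma complex_Im_conj z : complex.Im z^* = - complex.Im z.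
Proof. by case: z. Qed.
Lemma complex_eq z w : complex.Re z = complex.Re w -> complex.Im z = complex.Im w ->
  z = w.
Proof. by case: z w => [? ?] [? ?] /= -> ->. Qed.
Lemma complex_ge0P z : 0 <= z <-> complex.Im z = 0 /\ 0 <= complex.Re z.
Proof. by rewrite lecE /=; split=> [/andP[/eqP]|[-> ->]]//; rewrite eqxx. Qed.
End ComplexParts.

(** Over the complex numbers a sesquilinear form with real diagonal is hermitian:
    polarize with x + y and x + i y. *)
Lemma hermitian_polar (R : realType) (V : lmodType R[i]) (f : V -> V -> R[i]) :
  (forall x y z, f (x + y) z = f x z + f y z) ->
  (forall x y z, f z (x + y) = f z x + f z y) ->
  (forall x y, f ('i *: x) y = 'i * f x y) ->
  (forall x y, f x ('i *: y) = - ('i * f x y)) ->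
  (forall x, complex.Im (f x x) = 0) -> forall x y, f x y = (f y x)^*.
Proof.
move=> fDl fDr fil fir f0 x y.
have h u v : complex.Im (f u v) = - complex.Im (f v u).
  have := f0 (u + v); rewrite fDl !fDr !complex_ImD !f0; lra.
apply: complex_eq; last by rewrite complex_Im_conj h.
have := h x ('i *: y); rewrite fil fir complex_Im_i complex_Re_conj.
by case: (f x y) => p q /=; lra.
Qed.

Section Hilbert.
Context {R : realType} {H : hilbert R}.
Implicit Types (x y z : H) (a b : bop H).

Definition rdot x y : R := complex.Re '[x, y].

Lemma innerC x y : '[x, y] = ('[y, x])^*.
Proof. by rewrite hermC expr0 mul1r. Qed.
Lemma innerZl k x y : '[k *: x, y] = k * '[x, y].
Proof. exact: linearZl_LR. Qed.
Lemma innerZr k x y : '[x, k *: y] = k^* * '[x, y].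
Proof. exact: linearZr_LR. Qed.

Lemma psd_rdot : psd rdot.
Proof.
split=> [x y z|t x y|x y|x y|x]; rewrite /rdot.
- by rewrite linearDl complex_ReD.
- by rewrite innerZl complex_ReZ.
- by rewrite innerC complex_Re_conj.
- rewrite innerZl innerZr; case: '[x, y] => p q /=; ring.
- by have /complex_ge0P[] := dnorm_ge0 (inner H) x.
Qed.

Lemma rdot_sq x : '[x, x] = (rdot x x)%:C.
Proof. by have /complex_ge0P[h _] := dnorm_ge0 (inner H) x; apply: complex_eq. Qed.

Lemma norm_snorm x : `|x| = (snorm rdot x)%:C.
Proof.
apply/eqP; rewrite -(@eqrXn2 _ 2)//; last by rewrite lecR snorm_ge0.
by rewrite inner_norm rdot_sq -rmorphXn snorm_sq//; apply: psd_rdot.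
Qed.

Lemma rdot_eq0 x : rdot x x = 0 -> x = 0.
Proof.
by move=> h; apply/eqP; rewrite -(dnorm_eq0 (inner H)) rdot_sq h rmorph0.
Qed.

(** Real inner products against x and i x recover the complex one, so identities
    may be checked on [rdot]. *)
Lemma im_rdot x y : complex.Im '[x, y] = rdot x ('i *: y).
Proof.
rewrite /rdot innerZr; case: '[x, y] => p q /=.
by rewrite mul0r mulN1r sub0r opprK.
Qed.

Lemma inner_ext x y : (forall z, rdot x z = rdot y z) -> x = y.
Proof.
move=> h; apply/subr0_eq/rdot_eq0.
by rewrite (psdD psd_rdot) (psdN psd_rdot) h subrr.
Qed.

Lemma bopD a x y : a (x + y) = a x + a y.
Proof. by have := bop_linear a 1 x y; rewrite !scale1r. Qed.
Lemma bop0 a : a 0 = 0.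
Proof. by apply: (addrI (a 0)); rewrite -bopD !addr0. Qed.
Lemma bopZ a k x : a (k *: x) = k *: a x.
Proof. by have := bop_linear a k x 0; rewrite bop0 !addr0. Qed.
Lemma bopN a x : a (- x) = - a x.
Proof. by rewrite -scaleN1r bopZ scaleN1r. Qed.
Lemma bopB a x y : a (x - y) = a x - a y.
Proof. by rewrite bopD bopN. Qed.
Lemma bop_sum a I (r : seq I) (P : pred I) (F : I -> H) :
  a (\sum_(i <- r | P i) F i) = \sum_(i <- r | P i) a (F i).
Proof. by apply: (big_morph a (bopD a) (bop0 a)). Qed.

Lemma bop_bound a : exists2 c : R, 0 < c & forall x, snorm rdot (a x) <= c * snorm rdot x.
Proof.
have /asboolP[_ [c hc]] := bop_bounded a.
exists (`|complex.Re c| + 1); first by rewrite ltr_pwDr.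
move=> x; have := hc x; rewrite !norm_snorm lecE mulrC complex_ReZ /= => /andP[_ h].
have := ler_norm (complex.Re c); have := snorm_ge0 rdot x; nra.
Qed.

Lemma op_pos_selfadj a : op_pos a -> is_adjoint a a.
Proof.
move=> ha x y; rewrite [RHS]innerC.
apply: (@hermitian_polar _ _ (fun u v => '[a u, v])) => [u v w|u v w|u v|u v|u].
- by rewrite bopD linearDl.
- by rewrite linearDr.
- by rewrite bopZ innerZl.
- by rewrite innerZr; case: '[_, _] => p q; apply: complex_eq => /=; ring.
- by have /complex_ge0P[] := ha u.
Qed.

Lemma rdot_selfadj a : is_adjoint a a -> forall x y, rdot (a x) y = rdot x (a y).
Proof. by move=> ha x y; rewrite /rdot ha. Qed.

Lemma psd_op a : op_pos a -> psd (fun x y => rdot (a x) y).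
Proof.
move=> ha; split=> [x y z|t x y|x y|x y|x].
- by rewrite bopD (psdD psd_rdot).
- by rewrite bopZ (psdZ psd_rdot).
- by rewrite (rdot_selfadj (op_pos_selfadj ha)) (psdC psd_rdot).
- by rewrite bopZ (psdi psd_rdot).
- by have /complex_ge0P[] := ha x.
Qed.

Lemma op_posP a : is_adjoint a a -> (forall x, 0 <= rdot (a x) x) -> op_pos a.
Proof.
move=> sa ha x; apply/complex_ge0P; split; last exact: ha.
have := congr1 (@complex.Im R) (sa x x).
by rewrite [in RHS]innerC complex_Im_conj; lra.
Qed.

(** Completeness with an explicit rate, which the limit inherits. *)
Lemma hilbert_complete (u : nat -> H) (C : R) :
  (forall n m, (n <= m)%N -> snorm rdot (u m - u n) <= C / n.+1%:R) ->
  exists l, forall n, snorm rdot (u n - l) <= C / n.+1%:R.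
Proof.
move=> hu.
have C0 : 0 <= C.
  by have := hu 0%N 0%N isT; rewrite divr1 => /(le_trans (snorm_ge0 _ _)).
have cu : cauchy (u @ \oo).
  apply/cauchy_ballP => e e0.
  have [er0 ei] : 0 < complex.Re e /\ e = (complex.Re e)%:C.
    by move: e0; rewrite ltcE /= => /andP[/eqP h1 h2]; split=> //; apply: complex_eq.
  pose N := Num.truncn ((2 * C) / complex.Re e).
  have hN n : (N <= n)%N -> C / n.+1%:R < complex.Re e / 2.
    move=> Nn; have h : (2 * C) / complex.Re e < n.+1%:R.
      apply: lt_le_trans (truncnS_gt _) _.
      by rewrite ler_nat ltnS.
    have n0 : 0 < n.+1%:R :> R by rewrite ltr0n.
    by move: h; rewrite !ltr_pdivrMr//; nra.
  exists (u @` [set n | (N <= n)%N], u @` [set n | (N <= n)%N]).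
    by split; exists N => // n Nn; exists n.
  move=> [_ _] [/= [n Nn <-] [m Nm <-]]; rewrite -ball_normE /ball_ /= norm_snorm ei ltcR.
  have -> : u n - u m = (u n - u N) + (- (u m - u N)) by rewrite opprB addrA subrK.
  apply: le_lt_trans (snormD psd_rdot _ _) _; rewrite (snormN psd_rdot).
  have h := hN N (leqnn _); rewrite (splitr (complex.Re e)).
  exact: ltrD (le_lt_trans (hu _ _ Nn) h) (le_lt_trans (hu _ _ Nm) h).
have /cauchy_cvg /cvg_ex[l hl] := cu.
exists l => n; apply/ler_addgt0Pr => e e0.
have : \forall m \near \oo, `|l - u m| < e%:C.
  by move/cvgrPdist_lt : hl; apply; rewrite ltcR.
case=> N _ hN; pose m := maxn n N.
have -> : u n - l = - (u m - u n) + (- (l - u m)).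
  by rewrite !opprB addrA subrK.
apply: le_trans (snormD psd_rdot _ _) _; rewrite !(snormN psd_rdot) lerD//.
  by apply: hu; rewrite leq_maxl.
by have := hN m (leq_maxr _ _); rewrite norm_snorm ltcR => /ltW.
Qed.

End Hilbert.

(** * Square roots by Visser's iteration *)

Section Linear.
Context {R : realType} {V : lmodType R[i]}.

Lemma lin0 (f : V -> V) : linear f -> f 0 = 0.
Proof. by move=> lf; have := lf (-1) 0 0; rewrite scaler0 addr0 scaleN1r addNr. Qed.
Lemma linD (f : V -> V) : linear f -> forall x y, f (x + y) = f x + f y.
Proof. by move=> lf x y; have := lf 1 x y; rewrite !scale1r. Qed.
Lemma linZ (f : V -> V) : linear f -> forall k x, f (k *: x) = k *: f x.
Proof. by move=> lf k x; have := lf k x 0; rewrite (lin0 lf) !addr0. Qed.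
Lemma linB (f : V -> V) : linear f -> forall x y, f (x - y) = f x - f y.
Proof. by move=> lf x y; rewrite linD// -scaleN1r linZ// scaleN1r. Qed.

End Linear.

Section SquareRoot.
Context {R : realType} {V : lmodType R[i]}.
Variable b : V -> V -> R.
Hypothesis pb : psd b.

Lemma harmonic_le0 (x K : R) : (forall n, x <= K / n.+1%:R) -> x <= 0.
Proof.
move=> h; rewrite leNgt; apply/negP => x0.
have K0 : 0 < K by have := h 0%N; rewrite divr1; apply: lt_le_trans.
have := truncnS_gt (K / x); rewrite ltr_pdivrMr// => h1.
have n0 : 0 < (Num.truncn (K / x)).+1%:R :> R by rewrite ltr0n.
by have := h (Num.truncn (K / x)); rewrite ler_pdivlMr// mulrC leNgt h1.
Qed.

(** Convergence at rate 1/n.  Every limit used below has this rate, and an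
    explicit rate replaces any appeal to a topology on V. *)
Definition hconv (u : nat -> V) (l : V) : Prop :=
  exists K : R, forall n, snorm b (u n - l) <= K / n.+1%:R.

Hypothesis bdef : forall x, b x x = 0 -> x = 0.

Lemma hconv_unique u l l' : hconv u l -> hconv u l' -> l = l'.
Proof.
move=> [K hK] [K' hK']; apply/subr0_eq/bdef; apply/eqP.
rewrite eq_le psd_ge0// andbT -snorm_sq//.
suff h : snorm b (l - l') <= 0.
  have -> : snorm b (l - l') = 0 by apply/eqP; rewrite eq_le h snorm_ge0.
  by rewrite expr0n.
apply: (@harmonic_le0 _ (K + K')) => n.
apply: le_trans (snorm_sub pb _ (u n) _) _.
by rewrite mulrDl lerD// -(snormN pb) opprB.
Qed.

Lemma hconvD u v l m : hconv u l -> hconv v m ->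
  hconv (fun n => u n + v n) (l + m).
Proof.
move=> [K hK] [K' hK']; exists (K + K') => n.
rewrite opprD addrACA; apply: le_trans (snormD pb _ _) _.
by rewrite mulrDl lerD.
Qed.

Lemma hconv_bounded (f : V -> V) (c : R) u l :
  (forall x y, f (x - y) = f x - f y) -> (forall x, snorm b (f x) <= c * snorm b x) ->
  hconv u l -> hconv (fun n => f (u n)) (f l).
Proof.
move=> fB fc [K hK]; exists (`|c| * K) => n; rewrite -fB.
apply: le_trans (fc _) _; rewrite -mulrA.
apply: (@le_trans _ _ (`|c| * snorm b (u n - l))).
  by rewrite ler_wpM2r ?snorm_ge0// ler_norm.
by rewrite ler_wpM2l.
Qed.

Lemma hconvZ k u l : hconv u l -> hconv (fun n => k *: u n) (k *: l).
Proof.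
have [c _ hc] := snorm_scale pb k.
by apply: (hconv_bounded _ hc) => x y; rewrite scalerBr.
Qed.

Lemma hconv_cst l : hconv (fun=> l) l.
Proof. by exists 0 => n; rewrite subrr mul0r /snorm psd0l// sqrtr0. Qed.

Hypothesis bcomplete : forall (u : nat -> V) (C : R),
  (forall n m, (n <= m)%N -> snorm b (u m - u n) <= C / n.+1%:R) ->
  exists l, hconv u l.

Variable T : V -> V.
Hypothesis lT : linear T.
Hypothesis sT : forall x y, b (T x) y = b x (T y).
Hypothesis T_le1 : forall x, snorm b (T x) <= snorm b x.

Local Notation half := ((2^-1 : R)%:C).

(** If Y solves Y = (T + Y^2)/2 then (1 - Y)^2 = 1 - T, so that 1 - Y is a square
    root of 1 - T; [visser] is the fixed-point iteration from 0. *)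
Fixpoint visser (n : nat) (u : V) : V :=
  if n is n'.+1 then half *: (T u + visser n' (visser n' u)) else 0.

(** The same iteration for the scalar 1 in place of T: it majorizes the norms of
    the operators [visser n] and those of their increments. *)
Fixpoint visser_bound (n : nat) : R :=
  if n is n'.+1 then (1 + visser_bound n' ^+ 2) / 2 else 0.

Local Notation Y := visser.
Local Notation r := visser_bound.

Lemma visser_linear n : linear (Y n).
Proof.
elim: n => [|n IH] k x y /=; first by rewrite scaler0 addr0.
rewrite lT !IH scalerA mulrC -scalerA -scalerDr; congr (_ *: _).
by rewrite scalerDr addrACA.
Qed.

Lemma visser_sym n x y : b (Y n x) y = b x (Y n y).
Proof.
elim: n x y => [|n IH] x y /=; first by rewrite psd0l// psd0r.
by rewrite !(psdE pb) sT !IH.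
Qed.

(** Each iterate is a polynomial in T. *)
Lemma visser_comm (Z : V -> V) : linear Z -> (forall x, Z (T x) = T (Z x)) ->
  forall n x, Z (Y n x) = Y n (Z x).
Proof.
move=> lZ ZT; elim=> [|n IH] x /=; first exact: lin0.
by rewrite linZ// linD// ZT !IH.
Qed.

Lemma visser_commY n m x : Y m (Y n x) = Y n (Y m x).
Proof.
apply: visser_comm; first exact: visser_linear.
by move=> z; symmetry; apply: visser_comm.
Qed.

Lemma visser_bound01 n : 0 <= r n <= 1.
Proof.
elim: n => [|n /andP[h1 h2]] /=; rewrite ?lexx ?ler01//.
by apply/andP; split; nra.
Qed.

(** With e = 1 - r the recursion reads e' = e - e^2/2, which is increasing on
    [0,1], and 2/(n+2) is a supersolution. *)
Lemma visser_bound_rate n : 1 - r n <= 2 / n.+2%:R.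
Proof.
elim: n => [|n IH] /=; first by rewrite subr0 divff.
have /andP[h1 h2] := visser_bound01 n; move: (r n) IH h1 h2 => s.
have k0 : 0 <= n%:R :> R by rewrite ler0n.
have -> : n.+3%:R = n%:R + 3 :> R by rewrite -natrD addn3.
have -> : n.+2%:R = n%:R + 2 :> R by rewrite -natrD addn2.
move: (n%:R : R) k0 => k k0.
have k2 : 0 < k + 2 by lra.
have k3 : 0 < k + 3 by lra.
rewrite !ler_pdivlMr// => h h1 h2.
have -> : (1 - (1 + s ^+ 2) / 2) * (k + 3) = (1 - s ^+ 2) / 2 * (k + 3) by field.
pose e := 1 - s.
have -> : (1 - s ^+ 2) / 2 = e - e ^+ 2 / 2 by rewrite /e; field.
have e0 : 0 <= e by rewrite /e; lra.
have e1 : e <= 1 by rewrite /e; lra.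
move: h; rewrite -/e => h; move: e e0 e1 h => e e0 e1 h.
nra.
Qed.

Lemma visser_bounded n u : snorm b (Y n u) <= r n * snorm b u.
Proof.
elim: n u => [|n IH] u /=; first by rewrite mul0r /snorm psd0l// sqrtr0.
rewrite (snormZ pb) ger0_norm ?invr_ge0// (mulrC _ 2^-1) -mulrA ler_wpM2l ?invr_ge0//.
apply: le_trans (snormD pb _ _) _; rewrite mulrDl mul1r lerD//.
apply: le_trans (IH _) _; rewrite expr2 -mulrA ler_wpM2l//.
by have /andP[] := visser_bound01 n.
Qed.

(** Y^2 - Y'^2 = (Y + Y')(Y - Y') for the commuting iterates, so the bounds
    multiply as the scalar ones do. *)
Lemma visser_step n u : snorm b (Y n.+1 u - Y n u) <= (r n.+1 - r n) * snorm b u.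
Proof.
elim: n u => [|n IH] u; first by rewrite [Y 0 u]/= !subr0; apply: visser_bounded.
set w := Y n.+1 u - Y n u.
have -> : Y n.+2 u - Y n.+1 u = half *: (Y n.+1 w + Y n w).
  rewrite /w (linB (visser_linear n.+1)) (linB (visser_linear n)).
  rewrite (visser_commY n n.+1 u) addrA subrK.
  have E k : Y k.+1 u = half *: (T u + Y k (Y k u)) by [].
  by rewrite (E n.+1) [in X in _ - X](E n) -scalerBr opprD addrACA subrr add0r.
rewrite (snormZ pb) ger0_norm ?invr_ge0//.
have -> : r n.+2 - r n.+1 = 2^-1 * ((r n.+1 + r n) * (r n.+1 - r n)).
  have E k : r k.+1 = (1 + r k ^+ 2) / 2 by [].
  rewrite (E n.+1); have := E n; set s := r n.+1; set p := r n => hs.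
  by rewrite (_ : (s + p) * (s - p) = s ^+ 2 - p ^+ 2); [lra|ring].
rewrite -mulrA ler_wpM2l ?invr_ge0//; apply: le_trans (snormD pb _ _) _.
have hb := visser_bounded n w; have hb1 := visser_bounded n.+1 w.
have /andP[r0 _] := visser_bound01 n; have /andP[r1 _] := visser_bound01 n.+1.
have hw := IH u.
move: (r n) (r n.+1) (snorm b w) (snorm b _) (snorm b _) (snorm b u) r0 r1 hw hb hb1.
move=> p q s t1 t2 t *; nra.
Qed.

Lemma visser_cauchy u n m : (n <= m)%N ->
  snorm b (Y m u - Y n u) <= (2 * snorm b u) / n.+1%:R.
Proof.
move=> nm; apply: (@le_trans _ _ ((r m - r n) * snorm b u)).
  move: nm => /subnK <-; elim: (m - n)%N => [|k IH].
    by rewrite add0n !subrr mul0r /snorm psd0l// sqrtr0.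
  rewrite addSn; apply: le_trans (snorm_sub pb _ (Y (k + n) u) _) _.
  have := visser_step (k + n) u; lra.
rewrite mulrAC ler_wpM2r ?snorm_ge0//.
apply: (@le_trans _ _ (2 / n.+2%:R)).
  apply: le_trans (visser_bound_rate n); rewrite lerD2r.
  by have /andP[] := visser_bound01 m.
by rewrite ler_pM2l// lef_pV2 ?posrE ?ltr0n// ler_nat.
Qed.

(** The iterates form a Cauchy sequence of rate 1/n; symmetry, the equation and
    commutation with T pass to the limit, and S is 1 minus the limit. *)
Theorem sqrt_one_sub : exists S : V -> V,
  [/\ linear S, forall x y, b (S x) y = b x (S y),
      exists c, forall x, snorm b (S x) <= c * snorm b x,
      forall x, S (S x) = x - T x &
      forall (Z : V -> V) (c : R), linear Z ->
        (forall x, snorm b (Z x) <= c * snorm b x) ->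
        (forall x, Z (T x) = T (Z x)) -> forall x, Z (S x) = S (Z x)].
Proof.
have /choice[L hL] u : exists l, hconv (Y ^~ u) l.
  by apply: bcomplete => n m; apply: visser_cauchy.
have lL : linear L.
  move=> k x y; apply: (hconv_unique (hL (k *: x + y))).
  have := hconvD (hconvZ k (hL x)) (hL y).
  by congr hconv; apply/funext => n; rewrite visser_linear.
have bL x : snorm b (L x) <= snorm b x.
  rewrite -subr_le0; have [K hK] := hL x; apply: (@harmonic_le0 _ K) => n.
  have h2 : snorm b (Y n x) <= snorm b x.
    apply: le_trans (visser_bounded _ _) _; rewrite ler_piMl ?snorm_ge0//.
    by have /andP[] := visser_bound01 n.
  rewrite lerBlDr -[X in snorm b X](subrK (Y n x)); apply: le_trans (snormD pb _ _) _.
  by rewrite lerD// -(snormN pb) opprB.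
have LL x : L x = half *: (T x + L (L x)).
  apply: (@hconv_unique (fun n => Y n.+1 x)).
    have [K hK] := hL x; exists K => n; apply: le_trans (hK _) _.
    have K0 : 0 <= K.
      by have := hK 0%N; rewrite divr1; apply: le_trans; rewrite snorm_ge0.
    by rewrite ler_wpM2l// lef_pV2 ?posrE ?ltr0n// ler_nat.
  apply: hconvZ; apply: hconvD; first exact: hconv_cst.
  have [K hK] := hL x; have [K' hK'] := hL (L x); exists (K + K') => n.
  apply: le_trans (snorm_sub pb _ (Y n (L x)) _) _; rewrite mulrDl lerD//.
  rewrite -(linB (visser_linear n)).
  apply: le_trans (visser_bounded _ _) _; apply: le_trans (hK n).
  by rewrite ler_piMl ?snorm_ge0//; have /andP[] := visser_bound01 n.
have sL x y : b (L x) y = b x (L y).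
  have [K hK] := hL x; have [K' hK'] := hL y.
  apply/subr0_eq/eqP; rewrite -normr_le0.
  apply: (@harmonic_le0 _ (K * snorm b y + snorm b x * K')) => n.
  have -> : b (L x) y - b x (L y) = b x (Y n y - L y) - b (Y n x - L x) y.
    by rewrite !(psdE pb) visser_sym; ring.
  apply: le_trans (ler_normB _ _) _; rewrite addrC mulrDl.
  have h1 := psd_norm_le pb (Y n x - L x) y.
  have h2 := psd_norm_le pb x (Y n y - L y).
  apply: lerD.
    apply: le_trans h1 _; rewrite mulrAC; apply: ler_wpM2r; last exact: hK.
    exact: snorm_ge0.
  apply: le_trans h2 _; rewrite -mulrA; apply: ler_wpM2l; last exact: hK'.
  exact: snorm_ge0.
exists (fun x => x - L x); split.
- by move=> k x y; rewrite lL scalerBr opprD addrACA.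
- by move=> x y; rewrite !(psdE pb) sL.
- exists 2 => x; apply: le_trans (snormB pb _ _) _; have := bL x; lra.
- move=> x; rewrite (linB lL); have h := LL x.
  have h2 : L x + L x = T x + L (L x).
    rewrite {1 2}h -scalerDl -rmorphD (_ : 2^-1 + 2^-1 = 1) ?scale1r//.
    by field.
  by rewrite -addrA -opprD addrA h2 addrK.
- move=> Z c lZ cZ ZT x; rewrite (linB lZ); congr (_ - _).
  apply: (@hconv_unique (fun n => Y n (Z x))); last exact: hL.
  have := hconv_bounded (linB lZ) cZ (hL x).
  by congr hconv; apply/funext => n; apply: visser_comm.
Qed.

End SquareRoot.

(** * Positive operator matrices and their square roots *)

(** Cauchy-Schwarz for the form of T: |Tx|^4 is at most <Tx,x><T Tx,Tx>, and the
    last factor is at most c |Tx|^2. *)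
Lemma psd_contract (R : realType) (V : lmodType R[i]) (b : V -> V -> R)
    (T : V -> V) (c : R) : psd b -> psd (fun x y => b (T x) y) -> 0 <= c ->
  (forall x, b (T x) x <= c * b x x) ->
  forall x, b (T x) (T x) <= c * b (T x) x.
Proof.
move=> pb pT c0 Tc x.
have h1 := psd_CS pT x (T x).
have h2 := Tc (T x); have h3 := psd_ge0 pb (T x); have h4 := psd_ge0 pT x.
have h5 := psd_ge0 pT (T x); move: h1 h2 h3 h4 h5.
rewrite /= (psdC pb _ x).
move: (b (T x) (T x)) (b x (T x)) (b (T (T x)) (T x)) => p q s h1 h2 h3 h4 h5.
have [p0|p0] := eqVneq p 0; first by rewrite p0 mulr_ge0.
have pp : 0 < p by rewrite lt_def p0.
by rewrite -(ler_pM2r pp); nra.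
Qed.

Section DirectSum.
Context {R : realType} {H : hilbert R} {I : finType}.
Implicit Types x y : I -> H.

Definition sdot x y : R := \sum_i rdot (x i) (y i).

Lemma psd_sdot : psd sdot.
Proof.
have pr := @psd_rdot R H.
split=> [x y z|t x y|x y|x y|x]; rewrite /sdot.
- by rewrite -big_split; apply: eq_bigr => i _; rewrite (psdD pr).
- by rewrite mulr_sumr; apply: eq_bigr => i _; rewrite (psdZ pr).
- by apply: eq_bigr => i _; rewrite (psdC pr).
- by apply: eq_bigr => i _; rewrite (psdi pr).
- by apply: sumr_ge0 => i _; rewrite (psd_ge0 pr).
Qed.

Lemma snorm_component x i : snorm rdot (x i) <= snorm sdot x.
Proof.
rewrite ler_sqrt; last exact: psd_ge0 psd_sdot _.
rewrite /sdot (bigD1 i)//= lerDl; apply: sumr_ge0 => j _.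
exact: psd_ge0 psd_rdot _.
Qed.

Lemma snorm_sdot_le x (c : R) : 0 <= c -> (forall i, snorm rdot (x i) <= c) ->
  snorm sdot x <= #|I|%:R * c.
Proof.
move=> c0 h.
rewrite -(@ler_pXn2r _ 2) ?nnegrE ?snorm_ge0 ?mulr_ge0// (snorm_sq psd_sdot).
apply: (@le_trans _ _ (#|I|%:R * c ^+ 2)).
  rewrite /sdot mulr_natl -sumr_const; apply: ler_sum => i _.
  by rewrite -(snorm_sq psd_rdot) ler_pXn2r ?nnegrE ?snorm_ge0.
rewrite exprMn ler_wpM2r ?sqr_ge0// -natrX ler_nat.
by case: #|I| => // n; rewrite -{1}(expn1 n.+1) leq_pexp2l.
Qed.

Lemma sdot_eq0 x : sdot x x = 0 -> x = 0.
Proof.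
move=> h; apply/funext => i; apply: rdot_eq0; apply/eqP.
have := snorm_component x i; rewrite {2}/snorm h sqrtr0 => hi.
have : snorm rdot (x i) = 0 by apply/eqP; rewrite eq_le hi snorm_ge0.
by rewrite -(snorm_sq psd_rdot) => ->; rewrite expr0n.
Qed.

Lemma sdot_complete (u : nat -> I -> H) (C : R) :
  (forall n m, (n <= m)%N -> snorm sdot (u m - u n) <= C / n.+1%:R) ->
  exists l, hconv sdot u l.
Proof.
move=> hu.
have C0 : 0 <= C.
  by have := hu 0%N 0%N isT; rewrite divr1 => /(le_trans (snorm_ge0 _ _)).
have /choice[l hl] i : exists l, forall n, snorm rdot (u n i - l) <= C / n.+1%:R.
  apply: hilbert_complete => n m nm; apply: le_trans (hu _ _ nm).
  exact: (snorm_component (u m - u n) i).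
exists l, (#|I|%:R * C) => n; rewrite -mulrA; apply: snorm_sdot_le => [|i].
  by rewrite divr_ge0.
exact: hl.
Qed.

Definition single (j : I) (u : H) : I -> H := fun k => if k == j then u else 0.

Lemma sdot_single j u y : sdot (single j u) y = rdot u (y j).
Proof.
rewrite /sdot (bigD1 j)//= /single eqxx big1 ?addr0// => k /negPf ->.
exact: psd0l psd_rdot _.
Qed.

Lemma sum_single x : x = \sum_j single j (x j).
Proof.
apply/funext => i; rewrite fct_sumE (bigD1 i)//= /single eqxx big1 ?addr0//.
by move=> j; rewrite eq_sym => /negPf ->.
Qed.

Lemma bop_of_linear (f : H -> H) (c : R) : linear f ->
  (forall u, snorm rdot (f u) <= c * snorm rdot u) ->
  exists a : bop H, forall u, a u = f u.
Proof.
move=> lf hf; have fb : f \in @bounded_linear R H.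
  apply/asboolP; split=> //; exists c%:C => u.
  by rewrite !norm_snorm -rmorphM lecR.
by exists (Bop fb).
Qed.

(** The index set is an arbitrary finite type so that matrices of matrices can be
    flattened to matrices indexed by pairs. *)
Definition opmat_pos (a : I -> I -> bop H) : Prop :=
  forall x, 0 <= \sum_i \sum_j '[a i j (x j), x i].

Definition opmat_act (a : I -> I -> bop H) x : I -> H :=
  fun i => \sum_j a i j (x j).

Lemma opmat_actE (a : I -> I -> bop H) x y :
  complex.Re (\sum_i \sum_j '[a i j (x j), y i]) = sdot (opmat_act a x) y.
Proof.
rewrite /sdot (big_morph _ (@complex_ReD R) (erefl _)); apply: eq_bigr => i _.
by rewrite /rdot /opmat_act linear_sumlz.
Qed.

Lemma opmat_act_linear (a : I -> I -> bop H) : linear (opmat_act a).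
Proof.
move=> k x y; apply/funext => i; rewrite /opmat_act.
have -> : (k *: (fun i0 => \sum_j a i0 j (x j)) +
           (fun i0 => \sum_j a i0 j (y j))) i =
          k *: (\sum_j a i j (x j)) + \sum_j a i j (y j) by [].
rewrite scaler_sumr -big_split; apply: eq_bigr => j _ /=.
by rewrite -bopZ -bopD.
Qed.

Lemma opmat_pos_psd a : opmat_pos a -> psd (fun x y => sdot (opmat_act a x) y).
Proof.
move=> pa; pose f x y := \sum_i \sum_j '[a i j (x j), y i].
have fC x y : f x y = (f y x)^*.
  apply: hermitian_polar => [u v w|u v w|u v|u v|u]; rewrite /f.
  - rewrite -big_split; apply: eq_bigr => i _; rewrite -big_split.
    by apply: eq_bigr => j _; rewrite bopD linearDl.
  - rewrite -big_split; apply: eq_bigr => i _; rewrite -big_split.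
    by apply: eq_bigr => j _; rewrite linearDr.
  - rewrite mulr_sumr; apply: eq_bigr => i _; rewrite mulr_sumr.
    by apply: eq_bigr => j _; rewrite bopZ innerZl.
  - rewrite mulr_sumr -sumrN; apply: eq_bigr => i _; rewrite mulr_sumr -sumrN.
    apply: eq_bigr => j _; rewrite innerZr; case: '[_, _] => p q.
    by apply: complex_eq => /=; ring.
  - by have /complex_ge0P[] := pa u.
split=> [x y z|t x y|x y|x y|x].
- by rewrite (linD (opmat_act_linear a)) (psdD psd_sdot).
- by rewrite (linZ (opmat_act_linear a)) (psdZ psd_sdot).
- by rewrite -!opmat_actE -/(f x y) fC complex_Re_conj.
- by rewrite (linZ (opmat_act_linear a)) (psdi psd_sdot).
- by rewrite -opmat_actE; have /complex_ge0P[] := pa x.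
Qed.

Lemma opmat_bound a : exists2 c : R, 0 < c &
  forall x, sdot (opmat_act a x) x <= c * sdot x x.
Proof.
have /choice[c hc] (p : I * I) : exists c : R, 0 < c /\
    forall u, snorm rdot (a p.1 p.2 u) <= c * snorm rdot u.
  by have [c c0 h] := bop_bound (a p.1 p.2); exists c.
exists (1 + \sum_i \sum_j c (i, j)).
  rewrite ltr_pwDl// sumr_ge0// => i _; apply: sumr_ge0 => j _.
  by apply: ltW; case: (hc (i, j)).
move=> x; rewrite mulrDl mul1r ler_wpDl ?(psd_ge0 psd_sdot)//.
rewrite {1}/sdot mulr_suml; apply: ler_sum => i _.
rewrite /opmat_act /rdot linear_sumlz (big_morph _ (@complex_ReD R) (erefl _)).
rewrite mulr_suml; apply: ler_sum => j _.
apply: le_trans (psd_le psd_rdot _ _) _.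
have [c0 /(_ (x j)) h] := hc (i, j).
rewrite -(snorm_sq psd_sdot) expr2 mulrA; apply: ler_pM; rewrite ?snorm_ge0//.
  apply: le_trans h _; rewrite ler_wpM2l ?(ltW c0)//; exact: snorm_component.
exact: snorm_component.
Qed.

(** With c a bound of the form of the matrix A, the operator 1 - A/c is a positive
    contraction of the direct sum, so A/c has a square root there; multiply it by
    the square root of c and read off the entries.  An operator commuting with
    the entries of A acts diagonally, hence commutes with A and with the root. *)
Theorem opmat_sqrt (a : I -> I -> bop H) : opmat_pos a ->
  exists y : I -> I -> bop H,
  [/\ forall i j u, a i j u = \sum_k y i k (y k j u),
      forall i j, is_adjoint (y i j) (y j i) &
      forall c : bop H, (forall i j, bopM c (a i j) = bopM (a i j) c) ->
        forall i j, bopM c (y i j) = bopM (y i j) c].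
Proof.
move=> pa; have pA := opmat_pos_psd pa.
have [c c0 hc] := opmat_bound a; set A := opmat_act a in pA hc.
have lA : linear A by exact: opmat_act_linear.
pose T x := x - c^-1%:C *: A x.
have sA x y : sdot (A x) y = sdot x (A y).
  by rewrite (psdC pA) (psdC psd_sdot).
have lT : linear T.
  move=> k x y; rewrite /T lA !scalerDr scalerN opprD addrACA !scalerA.
  by rewrite (mulrC k).
have sT x y : sdot (T x) y = sdot x (T y).
  by rewrite /T !(psdE psd_sdot) sA.
have T_ge0 x : 0 <= sdot (T x) x.
  rewrite /T !(psdE psd_sdot) subr_ge0 mulrC ler_pdivrMr// mulrC; exact: hc.
have pT : psd (fun x y => sdot (T x) y).
  split=> [x y z|t x y|x y|x y|x] //.
  - by rewrite (linD lT) (psdD psd_sdot).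
  - by rewrite (linZ lT) (psdZ psd_sdot).
  - by rewrite sT (psdC psd_sdot).
  - by rewrite (linZ lT) (psdi psd_sdot).
have T_le1 x : snorm sdot (T x) <= snorm sdot x.
  have T1 z : sdot (T z) z <= 1 * sdot z z.
    rewrite mul1r /T !(psdE psd_sdot) gerBl mulr_ge0 ?invr_ge0 ?(ltW c0)//.
    exact: psd_ge0 pA z.
  rewrite ler_sqrt ?(psd_ge0 psd_sdot)//.
  apply: le_trans (psd_contract psd_sdot pT ler01 T1 x) _; rewrite mul1r.
  by apply: le_trans (T1 x) _; rewrite mul1r.
have [S [lS sS [d hd] SS Scomm]] :=
  sqrt_one_sub psd_sdot sdot_eq0 sdot_complete lT sT T_le1.
pose r := Num.sqrt c.
have entry (p : I * I) : exists b : bop H,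
    forall u, b u = r%:C *: S (single p.2 u) p.1.
  apply: (@bop_of_linear _ (r * d)) => [k u v|u].
    have -> : single p.2 (k *: u + v) = k *: single p.2 u + single p.2 v.
      apply/funext => i; rewrite /GRing.add /GRing.scale /= /single.
      by case: eqVneq => // _; rewrite scaler0 addr0.
    by rewrite lS /= scalerDr !scalerA mulrC.
  rewrite (snormZ psd_rdot) ger0_norm ?sqrtr_ge0// -mulrA ler_wpM2l ?sqrtr_ge0//.
  apply: le_trans (snorm_component _ _) _; apply: le_trans (hd _) _.
  by rewrite {1}/snorm sdot_single /single eqxx.
have /choice[y' hy'] := entry; pose y i j := y' (i, j).
have hy i j u : y i j u = r%:C *: S (single j u) i by rewrite /y hy'.
exists y; split.
- move=> i j u.
  have -> : a i j u = A (single j u) i.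
    rewrite /A /opmat_act (bigD1 j)//= /single eqxx big1 ?addr0// => k /negPf ->.
    exact: bop0.
  have -> : A (single j u) = c%:C *: S (S (single j u)).
    rewrite SS /T opprB addrC subrK scalerA -rmorphM divff ?gt_eqF// rmorph1.
    by rewrite scale1r.
  rewrite [S (single j u)]sum_single (big_morph S (linD lS) (lin0 lS)).
  rewrite scaler_sumr fct_sumE; apply: eq_bigr => k _; rewrite !hy.
  have -> : single k (r%:C *: S (single j u) k) = r%:C *: single k (S (single j u) k).
    apply/funext => l; rewrite /GRing.scale /= /single.
    by case: eqVneq => // _; rewrite scaler0.
  rewrite (linZ lS) -[RHS]/(r%:C *: (r%:C *: S _ i)) scalerA -rmorphM -expr2.
  by rewrite sqr_sqrtr ?(ltW c0).
- move=> i j u v.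
  have sy w z : rdot (y i j w) z = rdot w (y j i z).
    rewrite !hy (psdZ psd_rdot) (psdZr psd_rdot); congr (_ * _).
    by rewrite -sdot_single (psdC psd_rdot) -sdot_single (psdC psd_sdot) sS.
  apply: complex_eq; first exact: sy.
  by rewrite !im_rdot -bopZ; apply: sy.
- move=> e ec i j; apply: bopP => u /=; rewrite !hy bopZ; congr (_ *: _).
  have [d' d0 hd'] := bop_bound e.
  pose Z (x : I -> H) : I -> H := fun i => e (x i).
  have lZ : linear Z by move=> k x z; apply/funext => l; rewrite /Z bop_linear.
  have ZA x : Z (A x) = A (Z x).
    apply/funext => l; rewrite /Z /A /opmat_act bop_sum; apply: eq_bigr => m _.
    by have /(congr1 (fun f : bop H => f (x m))) := ec l m.
  have -> : single j (e u) = Z (single j u).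
    apply/funext => l; rewrite /Z /single; case: eqVneq => // _.
    by rewrite bop0.
  rewrite -(Scomm Z (#|I|%:R * d'))//.
    move=> x; rewrite -mulrA; apply: snorm_sdot_le => [|l].
      by rewrite mulr_ge0 ?(ltW d0) ?snorm_ge0.
    apply: le_trans (hd' _) _; rewrite ler_wpM2l ?(ltW d0)//.
    exact: snorm_component.
  by move=> x; rewrite /T (linB lZ) (linZ lZ) ZA.
Qed.

(** What commutes with the entries commutes with those of the root, so a set that
    is its own bicommutant contains the latter. *)
Corollary bicommutant_opmat_sqrt (N : set (bop H)) (a : I -> I -> bop H) :
  commutant (commutant N) = N -> (forall i j, N (a i j)) -> opmat_pos a ->
  exists y : I -> I -> bop H,
  [/\ forall i j u, a i j u = \sum_k y i k (y k j u),
      forall i j, is_adjoint (y i j) (y j i) &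
      forall i j, N (y i j)].
Proof.
move=> NN Na /opmat_sqrt[y [h1 h2 h3]]; exists y; split=> // i j.
rewrite -NN => c cN; symmetry; apply: h3 => k l.
by apply: cN.
Qed.

End DirectSum.

(** * Complete positivity and the standard form *)

Section VonNeumann.
Context {R : realType} {H : hilbert R} (M : vnalg H).
Implicit Types a b : M.

Lemma vn_ext a b : (forall x, a x = b x) -> a = b.
Proof. by move=> h; apply: val_inj; apply: bopP. Qed.

Lemma vn_sum I (r : seq I) (P : pred I) (F : I -> M) x :
  (\sum_(i <- r | P i) F i) x = \sum_(i <- r | P i) F i x.
Proof. by apply: (big_morph (fun a : M => a x)). Qed.

Lemma adjoint_unique (K : hilbert R) (s t u : bop K) :
  is_adjoint s t -> is_adjoint s u -> t = u.
Proof.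
move=> st su; apply: bopP => x; apply: inner_ext => z.
by rewrite !(psdC psd_rdot _ z) /rdot -st -su.
Qed.

Lemma vn_adj_inner a x y : '[vn_adj a x, y] = '[x, a y].
Proof. by rewrite innerC -vn_adjP -innerC. Qed.

Lemma vn_adj_unique a b : is_adjoint a b -> b = vn_adj a.
Proof.
by move=> ab; apply: val_inj; apply: adjoint_unique ab (@vn_adjP _ _ _ a).
Qed.

(** A positive matrix over M is a sum of Gram matrices over M, the source of
    all complete positivity tests. *)
Lemma vn_opmat_factor (I : finType) (X : I -> I -> M) :
  opmat_pos (fun i j => X i j : bop H) -> exists y : I -> I -> M,
  forall i j, X i j = \sum_k vnM (vn_adj (y k i)) (y k j).
Proof.
move=> /(bicommutant_opmat_sqrt (vn_bicommutant M))[].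
  by move=> i j; apply/vn_predE; exact: vn_opP.
move=> z [h1 h2 h3].
pose y i j : M := VNElt ((vn_predE M (z i j)).2 (h3 i j)).
exists y => i j; apply: vn_ext => x; rewrite h1 vn_sum; apply: eq_bigr => k _.
by rewrite -(vn_adj_unique (h2 k i : is_adjoint (y k i) (y i k))).
Qed.

End VonNeumann.

(** The Gram matrix of v k, summed over k: the double sum is the sum over k of the
    squared norms of the row sums. *)
Lemma gram_ge0 (R : realType) (K : hilbert R) (I J : finType) (v : J -> I -> K)
    (f : I -> I -> R[i]) :
  (forall i j, f i j = \sum_k '[v k j, v k i]) -> 0 <= \sum_i \sum_j f i j.
Proof.
move=> hf; have -> : \sum_i \sum_j f i j =
    \sum_k '[\sum_j v k j, \sum_i v k i].
  under eq_bigr do under eq_bigr do rewrite hf.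
  under eq_bigr do rewrite exchange_big.
  rewrite exchange_big; apply: eq_bigr => k _.
  rewrite linear_sumr; apply: eq_bigr => i _; by rewrite linear_sumlz.
by apply: sumr_ge0 => k _; apply: dnorm_ge0.
Qed.

Section StandardForm.
Context {R : realType} {H K : hilbert R} {M : vnalg H} {N : vnalg K}.
Variable L : standard_form N.
Local Notation rep := (sf_rep L).

Lemma repD a b : rep (a + b) = rep a + rep b.
Proof. by have := sf_rep_linear L 1 a b; rewrite !scale1r. Qed.

Lemma rep0 : rep 0 = 0.
Proof. by have := sf_rep_linear L (-1) 0 0; rewrite scaler0 addr0 scaleN1r addNr. Qed.

Lemma rep_sum I (r : seq I) (P : pred I) (F : I -> N) :
  rep (\sum_(i <- r | P i) F i) = \sum_(i <- r | P i) rep (F i).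
Proof. exact: (big_morph rep repD rep0). Qed.

Lemma bop_sumE (V : hilbert R) I (r : seq I) (P : pred I) (F : I -> bop V) x :
  (\sum_(i <- r | P i) F i) x = \sum_(i <- r | P i) F i x.
Proof. by apply: (big_morph (fun a : bop V => a x)). Qed.

Lemma rep_inner (a b : N) x y :
  '[rep (vnM (vn_adj a) b) x, y] = '[rep b x, rep a y].
Proof.
by rewrite sf_repM /= [LHS]innerC -(sf_rep_adj a) -innerC.
Qed.

(** Positivity over N does not depend on the faithful representation: in either
    one a positive matrix has a square root whose entries lie in the algebra
    (the image of N is a von Neumann algebra), so that X = y* y holds
    abstractly. *)
Theorem rep_opmat_pos (I : finType) (X : I -> I -> N) :
  opmat_pos (fun i j => rep (X i j)) <-> opmat_pos (fun i j => X i j : bop K).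
Proof.
split; last first.
  move=> /vn_opmat_factor[y hy] x.
  apply: (@gram_ge0 _ _ _ _ (fun k i => rep (y k i) (x i))) => i j.
  rewrite hy rep_sum bop_sumE linear_sumlz; apply: eq_bigr => k _.
  exact: rep_inner.
move=> /(bicommutant_opmat_sqrt (@sf_rep_vn _ _ _ L))[].
  by move=> i j; exists (X i j).
move=> z [h1 h2 h3].
have /choice[y' hy'] (p : I * I) : exists y, rep y = z p.1 p.2.
  by have [y _ hy] := h3 p.1 p.2; exists y.
pose y i j := y' (i, j).
have hy i j : rep (y i j) = z i j by rewrite /y hy'.
have adjy i j : y j i = vn_adj (y i j).
  apply: (@sf_rep_inj _ _ _ L); apply: (@adjoint_unique _ _ (rep (y i j))).
    by rewrite !hy.
  exact: sf_rep_adj.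
have XE i j : X i j = \sum_k vnM (y i k) (y k j).
  apply: (@sf_rep_inj _ _ _ L); apply: bopP => x.
  rewrite h1 rep_sum bop_sumE; apply: eq_bigr => k _.
  by rewrite sf_repM /= !hy.
move=> x; apply: (@gram_ge0 _ _ _ _ (fun k i => y k i (x i))) => i j.
rewrite XE vn_sum linear_sumlz; apply: eq_bigr => k _ /=.
by rewrite (adjy k i) vn_adj_inner.
Qed.

(** Gram matrices of a single row generate all positive matrices over M, and
    positivity over N can be tested on the standard form.  The family F of maps
    indexed by J covers both maps into N and maps into matrices over N. *)
Theorem cp_on_rep (J : finType) (F : J -> J -> M -> N) :
  (forall i j, linear (F i j)) ->
  (forall n (X : 'I_n -> 'I_n -> M), opmat_pos (fun i j => X i j : bop H) ->
    opmat_pos (fun p q : 'I_n * J => F p.2 q.2 (X p.1 q.1) : bop K)) <->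
  (forall n (y : 'I_n -> M) (xi : 'I_n * J -> sf_space L),
    0 <= \sum_p \sum_q
      '[rep (F p.2 q.2 (vnM (vn_adj (y p.1)) (y q.1))) (xi q), xi p]).
Proof.
move=> lF; split=> [FP n y xi|FP n X].
  apply: (@rep_opmat_pos _ (fun p q => F p.2 q.2 _)).2 xi.
  apply: (FP _ (fun i j => vnM (vn_adj (y i)) (y j))) => x.
  apply: (@gram_ge0 _ _ _ unit (fun k i => y i (x i))) => i j.
  by rewrite (big_pred1 tt) => [|[]]//; rewrite vn_adj_inner.
move=> /vn_opmat_factor[y hy]; apply/rep_opmat_pos => xi.
rewrite (_ : \sum_p _ = \sum_k \sum_p \sum_q
    '[rep (F p.2 q.2 (vnM (vn_adj (y k p.1)) (y k q.1))) (xi q), xi p]).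
  by apply: sumr_ge0 => k _; apply: FP.
have F0 i j : F i j 0 = 0.
  by have := lF i j (-1) 0 0; rewrite scaler0 addr0 scaleN1r addNr.
have FD i j a b : F i j (a + b) = F i j a + F i j b.
  by have := lF i j 1 a b; rewrite !scale1r.
rewrite [RHS]exchange_big; apply: eq_bigr => p _; rewrite [RHS]exchange_big.
apply: eq_bigr => q _.
by rewrite hy (big_morph _ (FD _ _) (F0 _ _)) rep_sum bop_sumE linear_sumlz.
Qed.

Lemma CP_rep (Phi : M -> N) : CP M N Phi <-> linear Phi /\
  forall n (y : 'I_n -> M) (xi : 'I_n -> sf_space L),
    0 <= \sum_i \sum_j '[rep (Phi (vnM (vn_adj (y i)) (y j))) (xi j), xi i].
Proof.
have sumE (T : nmodType) n (f : 'I_n * unit -> 'I_n * unit -> T) :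
    \sum_p \sum_q f p q = \sum_i \sum_j f (i, tt) (j, tt).
  have E (g : 'I_n * unit -> T) : \sum_p g p = \sum_i g (i, tt).
    transitivity (\sum_i \sum_u g (i, u)).
      by rewrite pair_big /=; apply: eq_bigr => -[].
    by apply: eq_bigr => i _; rewrite (big_pred1 tt)// => -[].
  by rewrite E; apply: eq_bigr => i _; rewrite E.
split=> -[lP h]; split=> //.
  have [+ _] := @cp_on_rep unit (fun _ _ => Phi) (fun _ _ => lP).
  move=> h1 n y xi.
  have := h1 _ n y (fun p => xi p.1); rewrite sumE; apply.
  by move=> n' X /h hX x; rewrite sumE; apply: (hX (fun i => x (i, tt))).
have [_ +] := @cp_on_rep unit (fun _ _ => Phi) (fun _ _ => lP).
move=> h1 n X pX x.
have := h1 _ n X pX (fun p => x p.1); rewrite sumE; apply.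
by move=> n' y xi; rewrite sumE; apply: (h _ _ (fun i => xi (i, tt))).
Qed.

(** An n by n matrix over M_2(N) is a matrix over N indexed by pairs. *)
Lemma CP_matmap_rep (F : 'I_2 -> 'I_2 -> M -> N) :
  (forall i j, linear (F i j)) ->
  completely_positive (matmap F) <->
  forall n (y : 'I_n -> M) (xi : 'I_n -> 'I_2 -> sf_space L),
    0 <= \sum_i \sum_k \sum_j \sum_l
      '[rep (F k l (vnM (vn_adj (y i)) (y j))) (xi j l), xi i k].
Proof.
move=> lF.
have sumE (T : nmodType) n (f : 'I_n * 'I_2 -> 'I_n * 'I_2 -> T) :
    \sum_p \sum_q f p q = \sum_i \sum_k \sum_j \sum_l f (i, k) (j, l).
  have E (g : 'I_n * 'I_2 -> T) : \sum_p g p = \sum_i \sum_k g (i, k).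
    by rewrite pair_big /=; apply: eq_bigr => -[].
  by rewrite E; apply: eq_bigr => i _; apply: eq_bigr => k _; rewrite E.
have matE n (X : 'I_n -> 'I_n -> M) (x : 'I_n -> 'I_2 -> K) :
   \sum_i \sum_j os_dot (os_act (matmap F (X i j)) (x j)) (x i) =
   \sum_i \sum_k \sum_j \sum_l '[F k l (X i j) (x j l), x i k].
  apply: eq_bigr => i _; rewrite exchange_big /=; apply: eq_bigr => k _.
  by apply: eq_bigr => j _; rewrite linear_sumlz.
have [cp1 cp2] := @cp_on_rep 'I_2 F lF.
split=> [[_ h]|h].
  move=> n y xi.
  have := cp1 _ n y (fun p => xi p.1 p.2); rewrite sumE; apply.
  move=> n' X pX x; rewrite sumE.
  by have := h n' X pX (fun i k => x (i, k)); rewrite matE.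
split.
  by move=> k a b; apply/funext => i; apply/funext => j; apply: lF.
move=> n X pX x; rewrite matE.
have := cp2 _ n X pX (fun p => x p.1 p.2); rewrite sumE; apply.
move=> n' y xi; rewrite sumE; exact: (h n' y (fun i k => xi (i, k))).
Qed.

End StandardForm.

(** * The variational formula for operators *)

(** Given commuting positive A and B with sum C, and T positive below A with
    T C = A B, the difference D = A - T satisfies D C = A^2.  Formally
    T = A B / C, and the cost of the decomposition u = (u - w) + w,
    <A(u-w),u-w> + <Bw,w>, is minimal at w = A u / C, with value <Tu,u>.  As C
    need not be invertible, the minimizer is approximated by gradient descent,
    for which D C = A^2 gives closed formulas. *)
Section ParallelSumOperator.
Context {R : realType} {H : hilbert R}.
Variables A B T C D : bop H.
Hypothesis CE : forall x, C x = A x + B x.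
Hypothesis DE : forall x, D x = A x - T x.
Hypothesis pA : op_pos A.
Hypothesis pB : op_pos B.
Hypothesis pT : op_pos T.
Hypothesis pD : op_pos D.
Hypothesis AB : forall x, A (B x) = B (A x).
Hypothesis TC : forall x, T (C x) = A (B x).

Let psA : psd (fun x y => rdot (A x) y) := psd_op pA.
Let psD : psd (fun x y => rdot (D x) y) := psd_op pD.
Let pr : psd (@rdot R H) := psd_rdot.

Let pC : op_pos C.
Proof. by move=> x; have := addr_ge0 (pA x) (pB x); rewrite -linearDl CE. Qed.

Let psC : psd (fun x y => rdot (C x) y) := psd_op pC.

Let sA x y : rdot (A x) y = rdot x (A y).
Proof. exact: rdot_selfadj (op_pos_selfadj pA) x y. Qed.

Let AC x : A (C x) = C (A x).
Proof. by rewrite !CE bopD AB. Qed.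

Let DC x : D (C x) = A (A x).
Proof. by rewrite DE TC CE bopD addrK. Qed.

Let DleC x : rdot (D x) x <= rdot (C x) x.
Proof.
rewrite CE DE !(psdE pr).
have := psd_ge0 (psd_op pB) x; have := psd_ge0 (psd_op pT) x => /=; lra.
Qed.

Let AleC x : rdot (A x) x <= rdot (C x) x.
Proof. by rewrite CE !(psdE pr) lerDl; have := psd_ge0 (psd_op pB) x. Qed.

(** The expansion of <A(u-w),u-w> + <Bw,w>. *)
Definition split_cost (u w : H) : R :=
  rdot (A u) u - 2 * rdot (A u) w + rdot (C w) w.

Section Descent.
Variables (c : R) (u : H).
Hypothesis c0 : 0 < c.
Hypothesis hc : forall x, rdot (C x) x <= c * rdot x x.

Let P x := x - c^-1%:C *: C x.

(** Gradient descent for the equation C w = A u, with step 1/c. *)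
Fixpoint descent n : H :=
  if n is n'.+1 then descent n' + c^-1%:C *: (A u - C (descent n')) else 0.

Let w := descent.
Let p n := iter n P u.

(** The error operator of one step is P = 1 - C/c. *)
Lemma descent_residual n : A u - C (w n) = A (p n).
Proof.
elim: n => [|n IH] /=; first by rewrite bop0 subr0.
by rewrite -/(w n) bopD opprD addrA IH bopZ -/(p n) [in RHS]/P bopB bopZ AC.
Qed.

Lemma descent_A n : A (w n) = D u - D (p n).
Proof.
elim: n => [|n IH] /=; first by rewrite bop0 subrr.
have DP x : D (P x) = D x - c^-1%:C *: A (A x) by rewrite /P bopB bopZ DC.
rewrite -/(w n) -/(p n) bopD IH bopZ descent_residual DP.
by move: (D u) (D (p n)) (_ *: _) => x y z; rewrite opprB addrA addrAC.
Qed.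

(** The descent overshoots the minimum exactly by the form of D at P^n u. *)
Lemma descent_cost n :
  split_cost u (w n) = rdot (T u) u + rdot (D (p n)) (p n).
Proof.
have E1 : rdot (A u) (w n) = rdot (D u) u - rdot (D (p n)) u.
  by rewrite sA descent_A (psdC pr) !(psdE pr).
have E2 : rdot (C (w n)) (w n) =
    rdot (A u) (w n) - rdot (D u) (p n) + rdot (D (p n)) (p n).
  rewrite -{1}[C (w n)](subKr (A u)) descent_residual !(psdE pr) (sA (p n)).
  by rewrite descent_A !(psdE pr) !(psdC pr (p n)) opprB addrA addrAC.
rewrite /split_cost E2 E1 (_ : rdot (D u) (p n) = rdot (D (p n)) u).
  by rewrite DE !(psdE pr); ring.
exact: psdC psD u (p n).
Qed.

(** |Px|^2 <= |x|^2 - <Cx,x>/c since C^2 <= c C; summing along x = P^n u shows that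
    the numbers <C P^n u, P^n u> have a finite sum. *)
Lemma descent_small e : 0 < e -> exists n, rdot (C (p n)) (p n) < e.
Proof.
move=> e0; have [//|/forallNP h] := pselect (exists n, rdot (C (p n)) (p n) < e).
have a_ge n : e <= rdot (C (p n)) (p n) by rewrite leNgt; apply/negP/h.
have step x : rdot (P x) (P x) <= rdot x x - c^-1 * rdot (C x) x.
  have := psd_contract pr psC (ltW c0) hc x.
  rewrite /P /=; move: (C x) => y; rewrite !(psdE pr) (psdC pr x y) => h1.
  have k0 : 0 < c^-1 by rewrite invr_gt0.
  have : c^-1 * rdot y y <= rdot y x by rewrite mulrC ler_pdivrMr// mulrC.
  by move: (c^-1) k0 => k k0 h2; nra.
have sum n : rdot (p n) (p n) <= rdot u u - c^-1 * e * n%:R.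
  elim: n => [|n IH]; first by rewrite mulr0 subr0.
  apply: le_trans (step (p n)) _; rewrite -natr1.
  have : c^-1 * e <= c^-1 * rdot (C (p n)) (p n) by rewrite ler_pM2l ?invr_gt0.
  lra.
have : e <= 0; last by rewrite leNgt e0.
apply: (@harmonic_le0 _ _ (c * rdot u u)) => n.
have := sum n.+1; have := psd_ge0 pr (p n.+1).
rewrite ler_pdivlMr ?ltr0n// => h1 h2.
have : c^-1 * e * n.+1%:R <= rdot u u by lra.
by rewrite -mulrA mulrC ler_pdivrMr// (mulrC _ c).
Qed.

(** Expanding the cost around the n-th descent point, up to terms that vanish with
    <C P^n u, P^n u>. *)
Lemma split_cost_descent n v : split_cost u v >= rdot (T u) u
   - rdot (C (p n)) (p n) - 2 * rdot (A (p n)) v + 2 * rdot (D (p n)) u.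
Proof.
pose z := v - w n.
have E : split_cost u v = split_cost u (w n) + rdot (C z) z - 2 * rdot (A (p n)) z.
  rewrite /split_cost -descent_residual (_ : v = w n + z); last first.
    by rewrite /z addrC subrK.
  move: z => z; rewrite !bopD !(psdE pr).
  have -> : rdot (C z) (w n) = rdot (C (w n)) z by apply: psdC psC _ _.
  by ring.
have E2 : rdot (A (p n)) z =
    rdot (A (p n)) v - rdot (D (p n)) u + rdot (D (p n)) (p n).
  rewrite /z !(psdE pr) (sA _ (w n)) descent_A !(psdE pr) !(psdC pr (p n)).
  by rewrite (psdC psD u (p n)); ring.
rewrite E E2 descent_cost.
have := psd_ge0 psC z; have := DleC (p n); rewrite /=; lra.
Qed.

End Descent.

Lemma C_bound : exists2 c : R, 0 < c & forall x, rdot (C x) x <= c * rdot x x.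
Proof.
have [c c0 hc] := bop_bound C; exists c => // x.
apply: le_trans (psd_le pr _ _) _; rewrite -(snorm_sq pr) expr2 mulrA.
by apply: ler_wpM2r; [apply: snorm_ge0|apply: hc].
Qed.

Theorem split_cost_inf u e : 0 < e ->
  exists w, split_cost u w < rdot (T u) u + e.
Proof.
move=> e0; have [c c0 hc] := C_bound.
have [n hn] := descent_small u c0 hc e0.
exists (descent c u n); rewrite descent_cost// ltrD2l.
exact: le_lt_trans (DleC _) hn.
Qed.

(** The error terms are bounded by Cauchy-Schwarz for the forms of A and D, both
    below that of C. *)
Theorem split_cost_ge u w : rdot (T u) u <= split_cost u w.
Proof.
have [c c0 hc] := C_bound; apply/ler_addgt0Pr => e e0.
pose K := snorm (fun x y => rdot (A x) y) w + snorm (fun x y => rdot (D x) y) u.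
have K0 : 0 <= K by rewrite addr_ge0 ?snorm_ge0.
(* If <Cx,x> < d^2 and d <= 1, the three error terms add up to at most d (1 + 2 K). *)
pose d := Num.min 1 (e / (1 + 2 * K)).
have k1 : 0 < 1 + 2 * K by lra.
have d0 : 0 < d by rewrite lt_min ltr01 divr_gt0.
have d1 : d <= 1 by rewrite ge_min lexx.
have d2 : d * (1 + 2 * K) <= e by rewrite -ler_pdivlMr// ge_min lexx orbT.
have [n hn] := descent_small u c0 hc (exprn_gt0 2 d0).
have h1 := split_cost_descent c u n w.
set x := iter n _ u in hn h1.
have small (b : H -> H -> R) : b x x <= rdot (C x) x -> snorm b x <= d.
  move=> hb; rewrite /snorm -(ger0_norm (ltW d0)) -sqrtr_sqr ler_sqrt ?sqr_ge0//.
  exact: le_trans hb (ltW hn).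
have h2 : rdot (A x) w <= d * snorm (fun x y => rdot (A x) y) w.
  apply: le_trans (psd_le psA x w) _; rewrite ler_wpM2r ?snorm_ge0//.
  exact: small (AleC x).
have h3 : - (rdot (D x) u) <= d * snorm (fun x y => rdot (D x) y) u.
  have := psd_le psD (- x) u; rewrite (psdN psD) (snormN psD) => h.
  apply: le_trans h _; rewrite ler_wpM2r ?snorm_ge0//.
  exact: small (DleC x).
have h4 : rdot (C x) x <= d.
  by apply: le_trans (ltW hn) _; rewrite expr2 ler_piMr// ltW.
move: h1 h2 h3 h4 d2; rewrite /K; lra.
Qed.

End ParallelSumOperator.

(** * Spectral integrals *)

Section Density.
Local Open Scope ereal_scope.
Context d (T : measurableType d) (R : realType).
Import HBNNSimple.

(** If m1 has density k with respect to m2, integrals against m1 are integrals of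
    the product with k: true for indicators by hypothesis, hence for simple
    functions, and in general by monotone convergence. *)
Lemma ge0_integral_density (m1 m2 : {measure set T -> \bar R}) (D : set T)
    (k g : T -> \bar R) : measurable D ->
  measurable_fun D k -> (forall z, D z -> 0 <= k z) ->
  (forall z, D z -> k z \is a fin_num) ->
  measurable_fun D g -> (forall z, D z -> 0 <= g z) ->
  (forall A, measurable A -> A `<=` D -> m1 A = \int[m2]_(z in A) k z) ->
  \int[m1]_(z in D) g z = \int[m2]_(z in D) (g z * k z).
Proof.
move=> mD mk k0 kfin mg g0 m12.
pose h := nnsfun_approx mD mg.
have -> : \int[m1]_(x in D) g x =
    limn (fun n => \int[m1]_(x in D) (h n x)%:E).
  have gE x : D x -> g x = limn (fun n => (h n x)%:E).
    by move=> Dx; apply/esym/cvg_lim => //; exact: cvg_nnsfun_approx.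
  under eq_integral => x /[!inE] /gE -> //.
  apply: monotone_convergence => //.
  - by move=> n; apply/measurable_EFinP; apply: measurable_funTS.
  - by move=> n x Dx; rewrite lee_fin.
  - by move=> x Dx a b ab; rewrite lee_fin; exact/lefP/nd_nnsfun_approx.
have -> : \int[m2]_(x in D) (g x * k x) =
    limn (fun n => \int[m2]_(x in D) ((h n x)%:E * k x)).
  have gE x : D x -> g x * k x = limn (fun n => (h n x)%:E * k x).
    move=> Dx; apply/esym/cvg_lim => //; apply: cvgeZr; first exact: kfin.
    exact: cvg_nnsfun_approx.
  under eq_integral => x /[!inE] /gE -> //.
  apply: monotone_convergence => //.
  - move=> n; apply: emeasurable_funM => //.
    by apply/measurable_EFinP; apply: measurable_funTS.
  - by move=> n x Dx; rewrite mule_ge0 ?lee_fin ?k0.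
  - move=> x Dx a b ab; rewrite lee_wpmul2r ?k0// lee_fin.
    exact/lefP/nd_nnsfun_approx.
congr (limn _); apply/funext => n.
transitivity (\sum_(r \in range (h n))
    (r%:E * m1 (h n @^-1` [set r] `&` D))).
  transitivity (\int[m1]_(x in D) (\sum_(r \in range (h n))
     (r * \1_(h n @^-1` [set r]) x)%:E)).
    by apply: eq_integral => t tD; rewrite fimfunE -fsumEFin.
  rewrite ge0_integral_fsum//; last 2 first.
  - move=> r; apply/measurable_EFinP; apply: measurable_funTS.
    exact: measurable_funM.
  - by move=> r x Dx; exact: nnfun_muleindic_ge0.
  apply: eq_fsbigr => r _.
  under eq_integral do rewrite EFinM.
  by rewrite integralZl_indic_nnsfun// integral_indic.
transitivity (\int[m2]_(x in D) (\sum_(r \in range (h n))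
     ((r * \1_(h n @^-1` [set r]) x)%:E * k x))); last first.
  apply: eq_integral => t tD.
  rewrite -ge0_mule_fsuml => [|r]; last exact: nnfun_muleindic_ge0.
  by rewrite fsumEFin// -(fimfunE _ t).
rewrite ge0_integral_fsum//; last 2 first.
- move=> r; apply: emeasurable_funM => //; apply/measurable_EFinP.
  by apply: measurable_funTS; exact: measurable_funM.
- by move=> r x Dx; rewrite mule_ge0 ?k0// nnfun_muleindic_ge0.
apply: eq_fsbigr => r /[!inE] -[t _ rE].
under [RHS]eq_integral do rewrite EFinM -muleA.
rewrite ge0_integralZl//.
- congr (_ * _); under eq_integral do rewrite muleC.
  rewrite (eq_integral (k \_ (h n @^-1` [set r]))); last first.
    by move=> x xE; rewrite epatch_indic.
  rewrite -integral_mkcondr [in RHS]setIC m12//.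
  by apply: measurableI => //; exact: measurable_funPTI.
- apply: emeasurable_funM => //; apply/measurable_EFinP.
  exact: measurable_funTS.
- by move=> x Dx; rewrite mule_ge0 ?k0// lee_fin.
- by rewrite lee_fin -rE.
Qed.

Lemma ge0_density_measure (m : {measure set T -> \bar R}) (D : set T)
    (k : T -> \bar R) : measurable D -> measurable_fun D k ->
  (forall z, D z -> 0 <= k z) ->
  exists m' : {measure set T -> \bar R},
    forall A, m' A = \int[m]_(z in A `&` D) k z.
Proof.
move=> mD mk k0; pose nu A := \int[m]_(z in A `&` D) k z.
have nu0 : nu set0 = 0 by rewrite /nu set0I integral_set0.
have nu_ge0 A : 0 <= nu A by apply: integral_ge0 => z [_ /k0].
have nu_sigma : semi_sigma_additive nu.
  move=> F mF tF mUF; rewrite /nu setI_bigcupl ge0_integral_bigcup//=.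
  - by apply: is_cvg_nneseries => n _ _; apply: nu_ge0.
  - by move=> n; apply: measurableI.
  - by rewrite -setI_bigcupl; apply: measurable_funS mk => //; apply: subIsetr.
  - by move=> x [n _ [_ /k0]].
  - exact: trivIset_setIr.
pose mu' := @isMeasure.Build _ _ _ nu nu0 nu_ge0 nu_sigma.
pose m' : {measure set T -> \bar R} := HB.pack nu mu'.
by exists m'.
Qed.

End Density.

Lemma measurable_quadrant (R : realType) :
  measurable (quadrant : set (R * R)).
Proof.
have -> : (quadrant : set (R * R)) = `[0, +oo[ `*` `[0, +oo[.
  by apply/seteqP; split=> [z [h1 h2]|z []]; rewrite /= !in_itv/= ?andbT//
    => h1 h2; split.
by apply: measurableX; exact: measurable_itv.
Qed.

Section Spectral.
Context {R : realType} {H : hilbert R} (E : spectral_measure H).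
Local Notation Q := (@quadrant R).
Local Notation proj := (spm_proj E).
Local Notation mu := (spm_scalar E).
Let pr : psd (@rdot R H) := psd_rdot.
Let mQ : measurable Q := @measurable_quadrant R.

Lemma proj_selfadj S x y : measurable S -> '[proj S x, y] = '[x, proj S y].
Proof. by move=> mS; apply: spm_selfadj. Qed.

Lemma proj_setI S S' x : measurable S -> measurable S' ->
  proj S (proj S' x) = proj (S `&` S') x.
Proof. by move=> mS mS'; rewrite spm_setI. Qed.

Lemma mu_rdot S x : measurable S -> mu x S = (rdot (proj S x) x)%:E.
Proof. exact: spm_scalarE. Qed.

Section Polarization.
Variables (g : R * R -> R) (G : bop H).
Hypothesis hG : spectral_integral E g G.
Hypothesis g0 : forall z, Q z -> 0 <= g z.

Lemma spectral_integrable x : (mu x).-integrable Q (EFin \o g).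
Proof. by have [] := hG x. Qed.

Lemma spectral_measurable : measurable_fun Q (EFin \o g).
Proof. exact: measurable_int (spectral_integrable 0). Qed.

Lemma spectral_integralE x :
  (\int[mu x]_(z in Q) (g z)%:E)%E = (rdot (G x) x)%:E.
Proof.
have [ig hx] := hG x; rewrite /rdot hx /= /Rintegral fineK//.
exact: integrable_fin_num ig.
Qed.

Lemma spectral_op_pos : op_pos G.
Proof.
move=> x; have [_ ->] := hG x; rewrite lecR /Rintegral fine_ge0//.
by apply: integral_ge0 => z Qz; rewrite lee_fin g0.
Qed.

(** Polarization without complex measures: when S |-> Re <E(S)u,v> is itself a
    measure m, the scalar measures of u + v/4 and u - v/4 differ by m, and so do
    their integrals. *)
Lemma spectral_polar (m : {measure set (R * R) -> \bar R}) u v :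
  (forall S, measurable S -> S `<=` Q -> m S = (rdot (proj S u) v)%:E) ->
  (\int[m]_(z in Q) (g z)%:E)%E = (rdot (G u) v)%:E.
Proof.
move=> hm; have [v' v'E] : exists v', v' = (4^-1 : R)%:C *: v by eexists.
have hv y : rdot y v' = 4^-1 * rdot y v by rewrite v'E (psdZr pr).
have sG x y : rdot (G x) y = rdot (G y) x.
  by rewrite (rdot_selfadj (op_pos_selfadj spectral_op_pos)) (psdC pr).
have sE S x y : measurable S -> rdot (proj S x) y = rdot (proj S y) x.
  by move=> mS; rewrite /rdot proj_selfadj// -/(rdot _ _) (psdC pr).
have add : (\int[mu (u + v')%R]_(z in Q) (g z)%:E =
    \int[mu (u - v')%R]_(z in Q) (g z)%:E + \int[m]_(z in Q) (g z)%:E)%E.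
  have mg := spectral_measurable.
  rewrite -ge0_integral_measure_add;
    [|exact: mQ|by move=> z Qz; rewrite lee_fin g0|exact: mg].
  apply: (@eq_measure_integral _ _ R Q _ _ (EFin \o g)) => S mS SQ.
  rewrite [RHS]measure_addE hm// !mu_rdot// -EFinD; congr EFin.
  by rewrite bopB bopD !(psdE pr) (sE S v' u)// !hv; lra.
move: add; rewrite !spectral_integralE => add.
have fin : (\int[m]_(z in Q) (g z)%:E)%E \is a fin_num.
  rewrite fin_numElt; apply/andP; split.
    apply: (@lt_le_trans _ _ 0%E) => //; apply: integral_ge0 => z Qz.
    by rewrite lee_fin g0.
  by move: add; case: (\int[m]_(z in Q) _)%E => // r _; rewrite ltry.
move: fin add => /fineK <-; rewrite -EFinD => -[] add; congr EFin.
by move: add; rewrite bopB bopD !(psdE pr) (sG v' u) !hv; lra.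
Qed.

Lemma spectral_polar0 u v :
  (forall S, measurable S -> '[proj S u, v] = 0) -> '[G u, v] = 0.
Proof.
have h w : (forall S, measurable S -> rdot (proj S u) w = 0) -> rdot (G u) w = 0.
  move=> hw; have := @spectral_polar mzero u w.
  rewrite integral_measure_zero => hz.
  by have [] : 0%:E = (rdot (G u) w)%:E by apply: hz => S mS _; rewrite hw.
move=> huv; apply: complex_eq => /=; first by apply: h => S mS; rewrite /rdot huv.
by rewrite im_rdot; apply: h => S mS; rewrite -im_rdot huv.
Qed.

(** E(S)x and x - E(S)x have mutually singular spectral measures, so G does not
    see the cross term. *)
Lemma spectral_corner S x : measurable S ->
  '[G (proj S x), x] = '[G (proj S x), proj S x].
Proof.
move=> mS; rewrite -{2}[x](subrK (proj S x)) linearDr /= spectral_polar0 ?add0r//.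
move=> S' mS'; rewrite linearBr /= !proj_setI// -[X in _ - X]proj_selfadj//.
have SS : S `&` (S' `&` S) = S' `&` S by rewrite setIC -setIA setIid.
have mSS : measurable (S' `&` S) := measurableI _ _ mS' mS.
by rewrite (proj_setI _ mS mSS) SS subrr.
Qed.

(** The scalar measure of E(S)x is the restriction to S of that of x. *)
Lemma spectral_corner_integral S x : measurable S -> S `<=` Q ->
  (\int[mu x]_(z in S) (g z)%:E)%E = (rdot (G (proj S x)) x)%:E.
Proof.
move=> mS SQ; rewrite /rdot spectral_corner// -/(rdot _ _) -spectral_integralE.
rewrite (@ge0_integral_density _ _ _ (mu (proj S x)) (mu x) Q (EFin \o \1_S)).
- rewrite -[S in LHS](setIidr SQ) integral_mkcondr; apply: eq_integral => z _.
  by rewrite -/((EFin \o g) z) epatch_indic.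
- exact: mQ.
- by apply/measurable_EFinP; exact: measurable_indic.
- by move=> z _; rewrite lee_fin.
- by [].
- exact: spectral_measurable.
- by move=> z Qz; rewrite lee_fin g0.
- move=> S' mS' S'Q; rewrite integral_indic// mu_rdot//; last first.
  rewrite mu_rdot; last exact: measurableI.
  have mSS : measurable (S' `&` S) := measurableI _ _ mS' mS.
  congr EFin; rewrite proj_setI// /rdot -(proj_selfadj _ _ mS) (proj_setI _ mS mSS).
  by rewrite (setIC S' S) setIA setIid.
Qed.

End Polarization.

(** Multiplicativity of the calculus, in weak form.  By the corner formula
    S |-> <E(S)x,Fx> is the measure with density f, and polarization
    integrates g against it; for the imaginary part that measure is zero. *)
Theorem spectral_mul (f g : R * R -> R) (F G : bop H) :
  spectral_integral E f F -> spectral_integral E g G ->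
  (forall z, Q z -> 0 <= f z) -> (forall z, Q z -> 0 <= g z) ->
  forall x, complex.Im '[G x, F x] = 0 /\
    (\int[mu x]_(z in Q) (g z * f z)%:E)%E = (rdot (G x) (F x))%:E.
Proof.
move=> hF hG f0 g0 x.
have sF y z : '[F y, z] = '[y, F z].
  exact: op_pos_selfadj (spectral_op_pos hF f0) y z.
have [m' hm'] := @ge0_density_measure _ _ _ (mu x) Q (EFin \o f) mQ
  (spectral_measurable hF) (fun z Qz => f0 z Qz).
split.
  rewrite im_rdot.
  have := @spectral_polar g G hG g0 mzero x ('i *: F x).
  rewrite integral_measure_zero => hz.
  have [] // : 0%:E = (rdot (G x) ('i *: F x))%:E.
  apply: hz => S mS SQ; rewrite -im_rdot -sF (spectral_corner hF f0)//.
  by have /complex_ge0P[->] := spectral_op_pos hF f0 (proj S x).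
rewrite -(@spectral_polar g G hG g0 m').
  rewrite (@ge0_integral_density _ _ _ m' (mu x) Q (EFin \o f))//.
  - exact: spectral_measurable hF.
  - exact: spectral_measurable hG.
  - by move=> A mA AQ; rewrite hm' setIidl.
move=> S mS SQ; rewrite hm' setIidl// (spectral_corner_integral hF f0)//.
by rewrite /rdot sF.
Qed.

End Spectral.

(** * The variational formula for the parallel sum of forms *)

Lemma parallel_fun_ge0 (R : realType) (z : R * R) :
  quadrant z -> 0 <= parallel_fun z.
Proof. by move=> [h1 h2]; rewrite /parallel_fun !(mulr_ge0, invr_ge0, addr_ge0). Qed.

Lemma parallel_fun_mul (R : realType) (z : R * R) : quadrant z ->
  parallel_fun z * z.1 + parallel_fun z * z.2 = z.1 * z.2.
Proof.
case: z => r s [/= h1 h2]; rewrite /parallel_fun -mulrDr /=.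
have [h|h] := eqVneq (r + s) 0; last by rewrite divfK.
have -> : r = 0 by lra.
by rewrite !mul0r.
Qed.

Lemma parallel_fun_le (R : realType) (z : R * R) : quadrant z ->
  parallel_fun z <= z.1.
Proof.
case: z => r s [/= h1 h2]; rewrite /parallel_fun /=.
have [h|h] := eqVneq (r + s) 0; first by rewrite h invr0 mulr0.
by rewrite ler_pdivrMr ?lt_def ?h ?addr_ge0// ler_wpM2l// lerDr.
Qed.

(** Polarization at the pairs x, X x and x, i X x. *)
Lemma op_eq0 (R : realType) (H : hilbert R) (X : bop H) :
  (forall x, '[X x, x] = 0) -> forall x, X x = 0.
Proof.
move=> X0 x.
have h u v : '[X u, v] + '[X v, u] = 0.
  by have := X0 (u + v); rewrite bopD linearDl /= !linearDr /= !X0 add0r addr0.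
have h1 := h x (X x); have := h x ('i *: X x).
rewrite innerZr bopZ innerZl => h2.
have : '[X x, X x] = 0; last by rewrite rdot_sq => -[] /rdot_eq0.
move: h1 h2; case: '[X x, X x] => a b; case: '[X (X x), x] => c d.
move=> [] h1 h1' [] /= h2 h2'; apply: complex_eq => /=; lra.
Qed.

Section ParallelCalculus.
Context {R : realType} {H : hilbert R} (A B T : bop H).
Hypothesis hT : borel_calculus A B parallel_fun T.

Lemma parallel_op_pos : op_pos T.
Proof.
have [E [_ _ hE]] := hT; exact: spectral_op_pos hE (@parallel_fun_ge0 R).
Qed.

Lemma parallel_op_le : op_pos (A - T).
Proof.
have [E [hA hB hE]] := hT.
have fst0 (z : R * R) : quadrant z -> 0 <= fst z by move=> [].
have pA := spectral_op_pos hA fst0.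
have sA := op_pos_selfadj pA; have sT := op_pos_selfadj parallel_op_pos.
have subE u : (A - T) u = A u - T u by [].
apply: op_posP => [x y|x]; rewrite !subE.
  by rewrite [LHS]linearBl [RHS]linearBr /= sA sT.
rewrite (psdD psd_rdot) (psdN psd_rdot) subr_ge0 -lee_fin.
rewrite -(spectral_integralE hE) -(spectral_integralE hA).
apply: ge0_le_integral.
- exact: measurable_quadrant.
- by move=> z Qz; rewrite lee_fin parallel_fun_ge0.
- exact: spectral_measurable hE.
- exact: spectral_measurable hA.
- by move=> z Qz; rewrite lee_fin parallel_fun_le.
Qed.

(** f(r,s) (r + s) = r s on the quadrant, so <Tx,Cx> = <Ax,Bx> for every x;
    polarization gives C T = B A, and then take adjoints.  This way commutation
    of T with A + B comes for free. *)
Lemma parallel_op_mul x : T (A x + B x) = A (B x).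
Proof.
have [E [hA hB hE]] := hT.
have fst0 (z : R * R) : quadrant z -> 0 <= fst z by move=> [].
have snd0 (z : R * R) : quadrant z -> 0 <= snd z by move=> [].
have T0 := @parallel_fun_ge0 R.
have sA := op_pos_selfadj (spectral_op_pos hA fst0).
have sB := op_pos_selfadj (spectral_op_pos hB snd0).
have sT := op_pos_selfadj parallel_op_pos.
have key y : '[T y, A y + B y] = '[A y, B y].
  have [i1 r1] := spectral_mul hA hE fst0 T0 y.
  have [i2 r2] := spectral_mul hB hE snd0 T0 y.
  have [i3 r3] := spectral_mul hB hA snd0 fst0 y.
  rewrite linearDr; apply: complex_eq; last by rewrite complex_ImD i1 i2 i3 addr0.
  rewrite complex_ReD; apply: EFin_inj; rewrite EFinD -!/(rdot _ _) -r1 -r2 -r3.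
  have mp := spectral_measurable hE.
  rewrite -ge0_integralD; last 5 first.
  - exact: measurable_quadrant.
  - by move=> z Qz; rewrite lee_fin mulr_ge0 ?T0 ?fst0.
  - apply/measurable_EFinP; apply: measurable_funM; apply/measurable_EFinP => //.
    exact: spectral_measurable hA.
  - by move=> z Qz; rewrite lee_fin mulr_ge0 ?T0 ?snd0.
  - apply/measurable_EFinP; apply: measurable_funM; apply/measurable_EFinP => //.
    exact: spectral_measurable hB.
  by apply: eq_integral => z; rewrite inE => Qz; rewrite -EFinD parallel_fun_mul.
have BA y : A (T y) + B (T y) = B (A y).
  pose X := bopM A T + bopM B T - bopM B A.
  apply/subr0_eq/(@op_eq0 _ _ X) => {}y.
  have -> : X y = A (T y) + B (T y) - B (A y) by [].
  have := key y; rewrite linearDr /= => k.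
  by rewrite linearBl linearDl /= sA sB sB k subrr.
apply: inner_ext => y.
have k : '[A x + B x, T y] = '[x, A (T y) + B (T y)].
  by rewrite linearDl linearDr /= sA sB.
by rewrite /rdot sT k BA -sB -sA.
Qed.

End ParallelCalculus.

Section FormParallelSum.
Context {R : realType} {V : lmodType R[i]}.
Variables al be ga : posform V.
Hypothesis par : is_form_parallel_sum al be ga.

(** The lower bound for the cost, at the vectors h(u) and w = -h(v). *)
Theorem form_parallel_sum_le u v :
  complex.Re (ga u u) <= complex.Re (al (u + v) (u + v)) + complex.Re (be v v).
Proof.
have [r [T [cT gaE]]] := par.
have pA : op_pos (cr_A r) := @cr_A_pos _ _ _ _ r.
have pB : op_pos (cr_B r) := @cr_B_pos _ _ _ _ r.
have AB x : cr_A r (cr_B r x) = cr_B r (cr_A r x).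
  by have /(congr1 (fun f : bop _ => f x)) := cr_comm r.
have := @split_cost_ge _ _ (cr_A r) (cr_B r) T (cr_A r + cr_B r) (cr_A r - T)
  (fun=> erefl) (fun=> erefl) pA pB (parallel_op_pos cT)
  (parallel_op_le cT) AB (parallel_op_mul cT) (cr_map r u) (- cr_map r v).
rewrite gaE (@cr_alpha _ _ _ _ r) (@cr_beta _ _ _ _ r) raddfD /= -/(rdot _ _) => h.
apply: le_trans h _; rewrite /split_cost -!/(rdot _ _) !bopN bopD.
rewrite (_ : (cr_A r + cr_B r) _ = cr_A r (cr_map r v) + cr_B r (cr_map r v))//.
rewrite !(psdE psd_rdot).
have -> : rdot (cr_A r (cr_map r v)) (cr_map r u) =
          rdot (cr_A r (cr_map r u)) (cr_map r v).
  exact: psdC (psd_op pA) _ _.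
lra.
Qed.

(** The cost is continuous in w and the vectors h(v) are dense, so the infimum over
    v already equals the infimum over all w. *)
Theorem form_parallel_sum_ge u (c : R) :
  (forall v, c <= complex.Re (al (u + v) (u + v)) + complex.Re (be v v)) ->
  c <= complex.Re (ga u u).
Proof.
move=> hc; have [r [T [cT gaE]]] := par.
have pA : op_pos (cr_A r) := @cr_A_pos _ _ _ _ r.
have pB : op_pos (cr_B r) := @cr_B_pos _ _ _ _ r.
have AB x : cr_A r (cr_B r x) = cr_B r (cr_A r x).
  by have /(congr1 (fun f : bop _ => f x)) := cr_comm r.
set A := cr_A r in AB cT *; set B := cr_B r in AB cT *.
have [C CE] : exists C : bop (cr_space r), forall x, C x = A x + B x by exists (A + B).
have pC : psd (fun x y => rdot (C x) y).
  apply: psd_op => x; have := addr_ge0 (pA x) (pB x).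
  by rewrite -linearDl -CE.
have pr := @psd_rdot R (cr_space r).
pose h := cr_map r.
have costE v : complex.Re (al (u + v) (u + v)) + complex.Re (be v v) =
    split_cost A C (h u) (- h v).
  rewrite (@cr_alpha _ _ _ _ r) (@cr_beta _ _ _ _ r) raddfD /= -!/(rdot _ _).
  rewrite /split_cost -/A -/B -/h.
  rewrite !bopN bopD CE !(psdE pr).
  have -> : rdot (A (h v)) (h u) = rdot (A (h u)) (h v).
    exact: psdC (psd_op pA) _ _.
  lra.
have TC x : T (C x) = A (B x) by rewrite CE parallel_op_mul.
apply/ler_addgt0Pr => e e0; rewrite gaE -/(rdot _ _) -/h.
have e2 : 0 < e / 2 by rewrite divr_gt0.
have [w hw] := @split_cost_inf _ _ A B T C (A - T)
  CE (fun=> erefl) pA pB (parallel_op_pos cT)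
  (parallel_op_le cT) AB TC (h u) (e / 2) e2.
have [b b0 hb] := bop_bound C.
pose K := 2 * snorm rdot (A (h u) - C w) + b.
have K0 : 0 < K by rewrite ltr_wpDl// mulr_ge0// snorm_ge0.
(* Moving w by less than d <= 1 changes the cost by at most d K. *)
pose d := Num.min 1 (e / 2 / K).
have d0 : 0 < d by rewrite lt_min ltr01 divr_gt0.
have d1 : d <= 1 by rewrite ge_min lexx.
have d2 : d * K <= e / 2 by rewrite -ler_pdivlMr// ge_min lexx orbT.
have dc0 : 0 < d%:C by rewrite ltcR.
have [] := @cr_dense _ _ _ _ r (ball (- w) d%:C)^°.
  exists (- w); exact: nbhsx_ballx.
  exact: open_interior.
move=> w' [/interior_subset hw' [v _ w'E]]; move: hw'; rewrite -w'E -/h.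
rewrite -ball_normE /= norm_snorm ltcR => hz.
set z := - w - h v in hz.
apply: le_trans (hc v) _; rewrite costE.
have -> : - h v = w + z by rewrite /z addrA subrr add0r.
have -> : split_cost A C (h u) (w + z) = split_cost A C (h u) w
    - 2 * rdot (A (h u) - C w) z + rdot (C z) z.
  move: z hz => z hz; rewrite /split_cost bopD !(psdE pr).
  have -> : rdot (C z) w = rdot (C w) z by exact: psdC pC z w.
  ring.
have z1 : - rdot (A (h u) - C w) z <= snorm rdot (A (h u) - C w) * d.
  have := psd_le pr (A (h u) - C w) (- z); rewrite (psdNr pr) (snormN pr) => hh.
  by apply: le_trans hh _; rewrite ler_wpM2l ?snorm_ge0// ltW.
have z2 : rdot (C z) z <= b * d.
  apply: le_trans (psd_le pr _ _) _.
  apply: (@le_trans _ _ (b * snorm rdot z * snorm rdot z)).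
    by rewrite ler_wpM2r ?snorm_ge0.
  rewrite -mulrA ler_wpM2l ?(ltW b0)//; apply: le_trans (ltW hz).
  by rewrite ler_piMl ?snorm_ge0//; exact: le_trans (ltW hz) d1.
move: hw z1 z2 d2; rewrite /K.
move: (split_cost _ _ _ _) (rdot (A (h u) - C w) z).
move: (snorm rdot (A _ - _)) (rdot (C z) z) (rdot (T _) _).
move=> s1 s2 s3 s4 s5 g1 g2 g3 g4.
lra.
Qed.

End FormParallelSum.

(** * Forms on the tensor product and the block map *)

Section Tensors.
Context {F : fieldType} {U V : lmodType F}.

Lemma tensor_sum (w : tensor U V) : exists n (u : 'I_n -> U) (v : 'I_n -> V),
  w = \sum_i tens (u i) (v i).
Proof.
have /asboolP[n [u [v h]]] := tensor_valP w; exists n, u, v; apply: val_inj.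
rewrite [LHS]h; symmetry.
by apply: (big_morph (fun t : tensor U V => val t)).
Qed.

Lemma tens0 (u : U) : tens u (0 : V) = 0.
Proof. by apply: val_inj; apply/funext => b; rewrite /= /tens_fun linear0r. Qed.

End Tensors.

Section Assembly.
Context {R : realType} {H K : hilbert R} {M : vnalg H} {N : vnalg K}.
Variable L : standard_form N.
Local Notation rep := (sf_rep L).
Implicit Types (Phi Psi Theta : M -> N).

(** The value at (sum y_i tensor x_i, sum y_i tensor z_i) of the form attached to Phi,
    which makes sense before such a form is known to exist. *)
Definition cp_sum Phi n (y : 'I_n -> M) (x z : 'I_n -> sf_space L) : R[i] :=
  \sum_i \sum_j '[rep (Phi (vnM (vn_adj (y i)) (y j))) (x j), z i].

Lemma cp_sumE Phi (s : posform (tensor M (sf_space L))) n (y : 'I_n -> M) x z :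
  is_cp_form Phi s -> s (\sum_i tens (y i) (x i)) (\sum_i tens (y i) (z i)) =
    cp_sum Phi y x z.
Proof.
move=> hs; rewrite linear_sumr; apply: eq_bigr => i _; rewrite linear_sumlz.
by apply: eq_bigr => j _; rewrite hs.
Qed.

Lemma linear_sub (A B : lmodType R[i]) (f g : A -> B) :
  linear f -> linear g -> linear (f - g).
Proof.
move=> lf lg k x y; rewrite -!/(_ - _) [LHS](_ : _ = f (k *: x + y) - g (k *: x + y))//.
rewrite lf lg opprD addrACA -scalerBr.
by [].
Qed.

Lemma mx22_linear (f g h k : M -> N) : linear f -> linear g -> linear h ->
  linear k -> forall i j, linear (mx22 f g h k i j).
Proof. by move=> lf lg lh lk i j; rewrite /mx22; do 2!case: ifP. Qed.

Definition block_map Phi Psi Theta : 'I_2 -> 'I_2 -> M -> N :=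
  fun i j => mx22 Phi Phi Phi (Phi + Psi) i j - mx22 Theta 0 0 0 i j.

Lemma block_mapE Phi Psi Theta :
  matmap (mx22 Phi Phi Phi (Phi + Psi)) - matmap (mx22 Theta 0 0 0) =
  matmap (block_map Phi Psi Theta).
Proof. by []. Qed.

Lemma block_sum Phi Psi Theta n (y : 'I_n -> M) (x : 'I_n -> 'I_2 -> sf_space L) :
  let x0 i := x i ord0 in let x1 i := x i (lift ord0 ord0) in
  \sum_i \sum_k \sum_j \sum_l
      '[rep (block_map Phi Psi Theta k l (vnM (vn_adj (y i)) (y j))) (x j l), x i k] =
  cp_sum Phi y x0 x0 + cp_sum Phi y x1 x0 + (cp_sum Phi y x0 x1 + cp_sum Phi y x1 x1)
  + cp_sum Psi y x1 x1 - cp_sum Theta y x0 x0.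
Proof.
move=> x0 x1; rewrite /cp_sum -!big_split -sumrB; apply: eq_bigr => i _ /=.
rewrite big_ord_recl big_ord1 -!big_split -sumrB /=; apply: eq_bigr => j _.
rewrite !big_ord_recl !big_ord0 /block_map /mx22 /= !addr0.
pose m := vnM (vn_adj (y i)) (y j).
have subE (f g : M -> N) v w : '[rep ((f - g) m) v, w] =
    '[rep (f m) v, w] - '[rep (g m) v, w].
  have -> : (f - g) m = (-1) *: g m + f m by rewrite scaleN1r addrC.
  by rewrite sf_rep_linear -linearBl; congr '[_, _]; rewrite [LHS]addrC [in LHS]scaleN1r.
have addE (f g : M -> N) v w : '[rep ((f + g) m) v, w] =
    '[rep (f m) v, w] + '[rep (g m) v, w].
  have -> : (f + g) m = f m + g m by [].
  by rewrite repD -linearDl.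
have zE v w : '[rep ((0 : M -> N) m) v, w] = 0.
  by rewrite (rep0 L) linear0l.
rewrite !subE !addE !zE !subr0 /x0 /x1.
ring.
Qed.

End Assembly.

Section BlockCriterion.
Context {R : realType} {H K : hilbert R} {M : vnalg H} {N : vnalg K}.
Variable L : standard_form N.
Local Notation rep := (sf_rep L).

Lemma block_map_linear (Phi Psi Theta : M -> N) :
  linear Phi -> linear Psi -> linear Theta ->
  forall i j, linear (block_map Phi Psi Theta i j).
Proof.
move=> l1 l2 l3 i j.
have l0 : linear (0 : M -> N) by move=> k x y /=; rewrite scaler0 addr0.
apply: linear_sub; apply: mx22_linear => //.
by move=> k x y; rewrite -[LHS]/(Phi _ + Psi _) l1 l2 addrACA -scalerDr.
Qed.

Lemma posform_re (V : lmodType R[i]) (s : posform V) x :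
  s x x = (complex.Re (s x x))%:C.
Proof. by have /complex_ge0P[h _] := pf_ge0 s x; apply: complex_eq. Qed.

(** At vectors with components u and v the block matrix of Phi and Psi has the form
    s(u+v,u+v) + t(v,v), so complete positivity of the difference says that Theta
    lies below this form.  The tensors u and v may be given by different elements
    of M: the concatenated family carries u in the first component on its first
    half and v in the second component on its second half. *)
Lemma block_cpP (Phi Psi Theta : M -> N) (s t : posform (tensor M (sf_space L))) :
  linear Phi -> linear Psi -> CP M N Theta ->
  is_cp_form Phi s -> is_cp_form Psi t ->
  cp_le (matmap (mx22 Theta 0 0 0)) (matmap (mx22 Phi Phi Phi (Phi + Psi))) <->
  forall n (y : 'I_n -> M) (x : 'I_n -> sf_space L) v,
    complex.Re (cp_sum Theta y x x) <=
      complex.Re (s (\sum_i tens (y i) (x i) + v) (\sum_i tens (y i) (x i) + v))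
      + complex.Re (t v v).
Proof.
move=> lP lPs cT hs ht; have lT := cT.1.
rewrite /cp_le block_mapE (CP_matmap_rep L (block_map_linear lP lPs lT)).
have blockE n (y : 'I_n -> M) (x : 'I_n -> 'I_2 -> sf_space L) :
   let u := \sum_i tens (y i) (x i ord0) in
   let v := \sum_i tens (y i) (x i (lift ord0 ord0)) in
  \sum_i \sum_k \sum_j \sum_l
      '[rep (block_map Phi Psi Theta k l (vnM (vn_adj (y i)) (y j))) (x j l), x i k] =
  s (u + v) (u + v) + t v v - cp_sum Theta y (fun i => x i ord0) (fun i => x i ord0).
  move=> u v; rewrite block_sum -!(cp_sumE _ _ _ hs) -(cp_sumE _ _ _ ht).
  by congr (_ + _ - _); rewrite [RHS]linearDl /= !linearDr addrACA.
have thetaE n (y : 'I_n -> M) (x : 'I_n -> sf_space L) :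
    cp_sum Theta y x x = (complex.Re (cp_sum Theta y x x))%:C.
  have hh := ((CP_rep L Theta).1 cT).2 n y x.
  have /complex_ge0P[h _] : 0 <= cp_sum Theta y x x := hh.
  by apply: complex_eq.
have ge0E n (y : 'I_n -> M) (x : 'I_n -> sf_space L) (p q : tensor M (sf_space L)) :
    0 <= s p p + t q q - cp_sum Theta y x x <->
    complex.Re (cp_sum Theta y x x) <= complex.Re (s p p) + complex.Re (t q q).
  rewrite (posform_re s) (posform_re t) thetaE -rmorphD -rmorphB lecR.
  by rewrite subr_ge0.
split=> h n y x; last first.
  rewrite blockE; apply/ge0E.
  exact: (h n y (fun i => x i ord0) (\sum_i tens (y i) (x i (lift ord0 ord0)))).
move=> v; set u := \sum_i _.
have [m [z [w vE]]] := tensor_sum v.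
pose Y (k : 'I_(n + m)) := match fintype.split k with inl i => y i | inr j => z j end.
pose X (k : 'I_(n + m)) (e : 'I_2) : sf_space L :=
  match fintype.split k with
  | inl i => if e == ord0 then x i else 0
  | inr j => if e == ord0 then 0 else w j end.
have splitl i : fintype.split (lshift m i) = inl i :> 'I_n + 'I_m.
  exact: (unsplitK (inl i)).
have splitr j : fintype.split (rshift n j) = inr j :> 'I_n + 'I_m.
  exact: (unsplitK (inr j)).
have uE : \sum_k tens (Y k) (X k ord0) = u.
  rewrite big_split_ord /= [X in _ + X]big1 ?addr0.
    by apply: eq_bigr => i _; rewrite /Y /X splitl.
  by move=> j _; rewrite /X splitr tens0.
have vE' : \sum_k tens (Y k) (X k (lift ord0 ord0)) = v.
  rewrite big_split_ord /= [X in X + _]big1 ?add0r.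
    by rewrite vE; apply: eq_bigr => i _; rewrite /Y /X splitr.
  by move=> j _; rewrite /X splitl tens0.
have := h _ Y X; rewrite blockE uE vE' => /ge0E.
suff -> : cp_sum Theta Y (fun i => X i ord0) (fun i => X i ord0) =
          cp_sum Theta y x x by [].
rewrite /cp_sum big_split_ord /= [X in _ + X]big1 ?addr0; last first.
  move=> j _; rewrite big1// => k _; by rewrite {2}/X splitr linear0r.
apply: eq_bigr => i _; rewrite big_split_ord /= [X in _ + X]big1 ?addr0; last first.
  by move=> j _; rewrite {1}/X splitr bop0 linear0l.
by apply: eq_bigr => j _; rewrite /X /Y !splitl.
Qed.

End BlockCriterion.

Theorem proposition3p11 (R : realType) (H K : hilbert R) (M : vnalg H)
    (N : vnalg K) (L : standard_form N) (Phi Psi Pi : M -> N)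
    (hPhi : CP M N Phi) (hPsi : CP M N Psi)
    (hPi : is_parallel_sum L Phi Psi Pi) :
  is_cp_max
    [set Theta | CP M N Theta /\
       cp_le (matmap (mx22 Theta 0 0 0))
             (matmap (mx22 Phi Phi Phi (Phi + Psi)))] Pi.
Proof.
have [cPi [s [t [p [hs ht hpar hp]]]]] := hPi.
have blockP Theta cT := @block_cpP R H K M N L Phi Psi Theta s t hPhi.1 hPsi.1 cT hs ht.
split.
  split=> //; apply/(blockP Pi cPi) => n y x v.
  rewrite -(cp_sumE _ _ _ hp); exact: form_parallel_sum_le hpar _ _.
move=> Theta [cT /(blockP Theta cT) hT].
apply/(CP_rep L); split; first exact: linear_sub cPi.1 cT.1.
move=> n y x.
have -> : \sum_i \sum_j '[sf_rep L ((Pi - Theta) (vnM (vn_adj (y i)) (y j))) (x j), x i]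
   = cp_sum Pi y x x - cp_sum Theta y x x.
  rewrite /cp_sum -sumrB; apply: eq_bigr => i _; rewrite -sumrB; apply: eq_bigr => j _.
  set m := vnM _ _.
  have -> : (Pi - Theta) m = (-1) *: Theta m + Pi m by rewrite scaleN1r addrC.
  by rewrite sf_rep_linear -linearBl; congr '[_, _]; rewrite [LHS]addrC [in LHS]scaleN1r.
have /complex_ge0P[iT _] : 0 <= cp_sum Theta y x x := ((CP_rep L Theta).1 cT).2 n y x.
rewrite -(cp_sumE _ _ _ hp); set u := \sum_i _.
have /complex_ge0P[ip _] := pf_ge0 p u.
apply/complex_ge0P; split.
  by move: iT ip; case: (p u u) (cp_sum _ _ _ _) => a b [c d] /= -> ->; rewrite subr0.
suff : complex.Re (cp_sum Theta y x x) <= complex.Re (p u u).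
  by case: (p u u) (cp_sum _ _ _ _) => a b [c d] /=; rewrite subr_ge0.
by apply: form_parallel_sum_ge hpar _ _ _ => v; apply: hT.
Qed.
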